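(* Let $R$ be a ring. The following statements are equivalent. 1. The ring $R$ has a semisimple left quotient ring. 2. The ring $R$ is a semiprime ring with $|\mathrm{Min}(R)|<\infty$ and, for each $\mathfrak p\in\mathrm{Min}(R)$, the ring $R/\mathfrak p$ is a left Goldie ring.
   Context: Rings are associative with $1\ne0$. $\mathrm{Min}(R)$ is the set of minimal prime ideals of $R$. A ring is a left Goldie ring if it satisfies the ascending chain condition on left annihilators and does not contain infinite direct sums of nonzero left ideals. Let $\mathcal C$ be the set of regular elements (non-zero-divisors) of $R$. $R$ has a left quotient ring if $\mathcal C$ is a left Ore set (i.e. $\mathcal Cr\cap Rc\ne\emptyset$ for all $r\in R$, $c\in\mathcal C$), and then the left quotient ring is $\mathcal C^{-1}R$. Semisimple means semisimple Artinian. *)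

(* Defs.v *)
From HB Require Import structures.
From mathcomp Require Import all_boot all_order all_algebra.
From mathcomp Require Import boolp classical_sets cardinality.

Set Implicit Arguments.
Unset Strict Implicit.
Unset Printing Implicit Defensive.

Import GRing.Theory.
Local Open Scope ring_scope.
Local Open Scope classical_set_scope.
Local Open Scope quotient_scope.

(* Rings are not assumed commutative: in [nzRingType], [1 != 0] is the only
   requirement beyond an associative unital ring. *)

Section Ideals.
Variable R : nzRingType.
Implicit Types I J P : set R.

Definition left_ideal I : Prop :=
  [/\ I 0, forall x y, I x -> I y -> I (x - y)
    & forall a x, I x -> I (a * x)].

Definition two_sided_ideal I : Prop :=
  left_ideal I /\ forall x a, I x -> I (x * a).

Definition proper_two_sided_ideal I : Prop := two_sided_ideal I /\ ~ I 1.

(* [I * J `<=` P] is equivalent to [x * y \in P] for all generators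
   [x \in I], [y \in J], since [P] is closed under addition. *)
Definition prime_ideal P : Prop :=
  proper_two_sided_ideal P /\
  forall I J, two_sided_ideal I -> two_sided_ideal J ->
    (forall x y, I x -> J y -> P (x * y)) -> I `<=` P \/ J `<=` P.

Definition minimal_primes : set (set R) :=
  [set P | prime_ideal P /\
           forall Q, prime_ideal Q -> Q `<=` P -> Q = P].

(* [I ^ n = 0], expressed on the products of [n] elements of [I], which
   generate [I ^ n] as an additive group. *)
Definition nilpotent_ideal I : Prop :=
  two_sided_ideal I /\ exists n : nat, forall x : 'I_n -> R,
    (forall i, I (x i)) -> \prod_(i < n) x i = 0.

Definition semiprime_ring : Prop :=
  forall I, nilpotent_ideal I -> I = [set 0].

End Ideals.
Arguments minimal_primes : clear implicits.
Arguments semiprime_ring : clear implicits.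

Section ChainConditions.
Variable R : nzRingType.
Implicit Types (F : set (set R)) (X I : set R).

Definition acc F : Prop :=
  forall A : nat -> set R, (forall n, F (A n)) ->
    (forall n, A n `<=` A n.+1) ->
    exists N, forall n, (N <= n)%N -> A n = A N.

Definition dcc F : Prop :=
  forall A : nat -> set R, (forall n, F (A n)) ->
    (forall n, A n.+1 `<=` A n) ->
    exists N, forall n, (N <= n)%N -> A n = A N.

Definition left_annihilator X : set R := [set r | forall x, X x -> r * x = 0].

Definition independent (A : nat -> set R) : Prop :=
  forall n (x : 'I_n -> R), (forall i : 'I_n, A i (x i)) ->
    \sum_(i < n) x i = 0 -> forall i, x i = 0.

Definition left_goldie : Prop :=
  acc (range left_annihilator) /\
  ~ exists A : nat -> set R,
      (forall n, left_ideal (A n) /\ A n <> [set 0]) /\ independent A.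

Definition minimal_left_ideal I : Prop :=
  [/\ left_ideal I, I <> [set 0]
    & forall J, left_ideal J -> J `<=` I -> J = [set 0] \/ J = I].

(* The regular left module is the sum of its simple submodules. *)
Definition left_semisimple : Prop :=
  forall x : R, exists (n : nat) (y : 'I_n -> R),
    (forall i, exists2 I, minimal_left_ideal I & I (y i)) /\
    x = \sum_(i < n) y i.

Definition left_artinian : Prop := dcc (@left_ideal R).

Definition semisimple_artinian : Prop := left_semisimple /\ left_artinian.

End ChainConditions.
Arguments left_goldie : clear implicits.
Arguments left_semisimple : clear implicits.
Arguments left_artinian : clear implicits.
Arguments semisimple_artinian : clear implicits.

Section LeftQuotientRing.
Variable R : nzRingType.

Definition regular_elements : set R := [set c | GRing.lreg c /\ GRing.rreg c].

Definition left_ore (C : set R) : Prop :=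
  forall r c, C c -> exists c' r', C c' /\ c' * r = r' * c.

(* [Q], together with [f], is the ring of left fractions [C^-1 R]. There is no
   loss in taking [Q] in [unitRingType]: classically, every ring carries this
   structure, with the two-sided invertible elements as units. *)
Definition is_left_localization (C : set R) (Q : unitRingType)
    (f : {rmorphism R -> Q}) : Prop :=
  [/\ forall c, C c -> f c \is a GRing.unit,
      forall q, exists c r, C c /\ q = (f c)^-1 * f r
    & forall r, f r = 0 <-> exists2 c, C c & c * r = 0].

Definition has_semisimple_left_quotient_ring : Prop :=
  left_ore regular_elements /\
  exists (Q : unitRingType) (f : {rmorphism R -> Q}),
    is_left_localization regular_elements f /\ semisimple_artinian Q.

End LeftQuotientRing.
Arguments has_semisimple_left_quotient_ring : clear implicits.

(* The library builds the additive quotient group [Quotient.quot] for any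
   additive subgroup, but its product only when the ring is commutative; here it
   is for a proper two-sided ideal of an arbitrary ring. *)
Section QuotientRing.
Variables (R : nzRingType) (I : set R) (hI : proper_two_sided_ideal I).

Definition ideal_pred of proper_two_sided_ideal I : {pred R} :=
  [pred x | `[< I x >]].

Fact ideal_predP x : reflect (I x) (x \in ideal_pred hI).
Proof. by rewrite unfold_in; apply: asboolP. Qed.

Fact ideal_pred_zmod_closed : zmod_closed (ideal_pred hI).
Proof.
have [[[I0 IB _] _] _] := hI; split=> [|x y Ix Iy].
  exact/ideal_predP.
by apply/ideal_predP/IB; apply/ideal_predP.
Qed.

HB.instance Definition _ :=
  GRing.isZmodClosed.Build R (ideal_pred hI) ideal_pred_zmod_closed.

Definition quotient_ring : Type := Quotient.quot (ideal_pred hI).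

HB.instance Definition _ := GRing.Zmodule.on quotient_ring.
HB.instance Definition _ : EqQuotient R (Quotient.equiv (ideal_pred hI))
  quotient_ring := EqQuotient.on quotient_ring.

Definition quotient_proj (x : R) : quotient_ring := \pi_quotient_ring x.

Fact quotient_projE x y : quotient_proj x = quotient_proj y <-> I (x - y).
Proof.
split=> [/eqP|/ideal_predP h]; last apply/eqP; rewrite eqquotE //.
by rewrite Quotient.equivE => /ideal_predP.
Qed.

Fact quotient_projK x : quotient_proj (repr x) = x.
Proof. exact: reprK. Qed.

Fact quotient_proj_zmod_morphism : zmod_morphism quotient_proj.
Proof. by move=> x y; rewrite /quotient_proj [LHS]raddfB. Qed.

Definition quotient_one : quotient_ring := quotient_proj 1.
Definition quotient_mul (x y : quotient_ring) : quotient_ring :=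
  quotient_proj (repr x * repr y).

Fact quotient_projM x y :
  quotient_proj (x * y) = quotient_mul (quotient_proj x) (quotient_proj y).
Proof.
have [[[I0 IB IM] MI] _] := hI; apply/quotient_projE.
set x' := repr _; set y' := repr _.
have hx : I (x - x') by apply/quotient_projE; rewrite quotient_projK.
have hy : I (y - y') by apply/quotient_projE; rewrite quotient_projK.
have -> : x * y - x' * y' = (x - x') * y - (- (x' * (y - y'))).
  by rewrite mulrBl mulrBr opprK addrA subrK.
by apply: IB; [exact: MI | rewrite -mulNr; exact: IM].
Qed.

Fact quotient_mulA : associative quotient_mul.
Proof.
move=> x y z; rewrite -[x]quotient_projK -[y]quotient_projK -[z]quotient_projK.
by rewrite -!quotient_projM mulrA.
Qed.

Fact quotient_mul1 : left_id quotient_one quotient_mul.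
Proof. by move=> x; rewrite -[x]quotient_projK -quotient_projM mul1r. Qed.

Fact quotient_1mul : right_id quotient_one quotient_mul.
Proof. by move=> x; rewrite -[x]quotient_projK -quotient_projM mulr1. Qed.

Fact quotient_projD x y :
  quotient_proj (x + y) = quotient_proj x + quotient_proj y.
Proof. by rewrite /quotient_proj [LHS]raddfD. Qed.

Fact quotient_mulDl : left_distributive quotient_mul +%R.
Proof.
move=> x y z; rewrite -[x]quotient_projK -[y]quotient_projK -[z]quotient_projK.
by rewrite -quotient_projD -!quotient_projM mulrDl quotient_projD.
Qed.

Fact quotient_mulDr : right_distributive quotient_mul +%R.
Proof.
move=> x y z; rewrite -[x]quotient_projK -[y]quotient_projK -[z]quotient_projK.
by rewrite -quotient_projD -!quotient_projM mulrDr quotient_projD.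
Qed.

Fact quotient_one_neq0 : quotient_one != 0.
Proof.
have [_ I1] := hI; apply/eqP => h; apply: I1; rewrite -[1]subr0.
apply/quotient_projE; rewrite -/quotient_one h.
by rewrite -[0 in RHS](subrr 0) quotient_proj_zmod_morphism subrr.
Qed.

HB.instance Definition _ := GRing.Zmodule_isNzRing.Build quotient_ring
  quotient_mulA quotient_mul1 quotient_1mul quotient_mulDl quotient_mulDr
  quotient_one_neq0.

HB.instance Definition _ := GRing.isZmodMorphism.Build R quotient_ring
  quotient_proj quotient_proj_zmod_morphism.
HB.instance Definition _ := GRing.isMonoidMorphism.Build R quotient_ring
  quotient_proj (erefl, quotient_projM).

End QuotientRing.

Fact minimal_prime_proper (R : nzRingType) (p : set R) :
  minimal_primes R p -> proper_two_sided_ideal p.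
Proof. by case=> -[]. Qed.

(* Main.v *)
Require Import Defs.
From HB Require Import structures.
From mathcomp Require Import all_boot all_order all_algebra.
From mathcomp Require Import boolp classical_sets functions cardinality.

(** The heart is Goldie's theorem: [R] has a semisimple left quotient ring
    exactly when it is semiprime and left Goldie. What remains is to compare the
    left Goldie condition on [R] with that on the factors by minimal primes.

    Goldie's theorem rests on one property, that essential left ideals of [R]
    contain regular elements. In a semiprime left Goldie ring nil left ideals
    vanish (nil_left_ideal_eq0), hence so does the left singular ideal
    (left_nonsingular), and a regular element is built in an essential left
    ideal as a sum of finitely many elements generating a direct sum
    (essential_left_regular, essential_regular). Applied to the essential left ideal
    of the [x] with [x r] in [R c], this gives the Ore condition, and so a ring of
    left fractions [Q] (left_localization_exists). Essential left ideals of [Q] then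
    contain a unit, so that every left ideal of [Q] has a complement; without
    infinite direct sums this gives both chain conditions, and semisimplicity
    (no_proper_essential_semisimple). Conversely, if [Q] is semisimple, its
    essential left ideals are trivial, whence those of [R] contain regular elements
    (regular_in_essential); the right annihilator of a nilpotent ideal is essential
    on the left, so [R] is semiprime; and the Goldie conditions descend from the
    chain conditions on left ideals of [Q].

    Suppose now that [R] is semiprime and left Goldie. Its minimal primes are the
    maximal elements among the left annihilators [l(I)] of nonzero two-sided
    ideals (minimal_primesE). The corresponding ideals [I] form a direct sum, so
    that there are finitely many of them, and since [I] meets [l(I)] trivially, the
    Goldie conditions pass to [R / l(I)] (quotient_annihilator_goldie).

    In the other direction, a semiprime ring has minimal primes with zero
    intersection (bigcap_minimal_primes). If these are finitely many and each factor
    is left Goldie, then left annihilators of [R] are controlled modulo each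
    prime (acc_annihilators_of_factors), and infinite direct sums are excluded by
    passing to one prime after another (no_infinite_direct_sum_of_factors). So
    [R] is left Goldie, and Goldie's theorem applies. *)

Set Implicit Arguments.
Unset Strict Implicit.
Unset Printing Implicit Defensive.

Import GRing.Theory.
Local Open Scope ring_scope.
Local Open Scope classical_set_scope.

(** * Left ideals and annihilators *)
Section LeftIdeals.
Variable R : nzRingType.
Implicit Types (I J K E : set R) (F : set (set R)).

Lemma left_ideal0 I : left_ideal I -> I 0.
Proof. by case. Qed.

Lemma left_idealM I a x : left_ideal I -> I x -> I (a * x).
Proof. by case=> _ _; exact. Qed.

Lemma left_idealN I x : left_ideal I -> I x -> I (- x).
Proof. by move=> hI Ix; rewrite -mulN1r; exact: left_idealM. Qed.

Lemma left_idealB I x y : left_ideal I -> I x -> I y -> I (x - y).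
Proof. by case=> _ + _; exact. Qed.

Lemma left_idealD I x y : left_ideal I -> I x -> I y -> I (x + y).
Proof.
by move=> hI Ix Iy; rewrite -[y]opprK; apply: left_idealB => //; apply: left_idealN.
Qed.

Lemma left_ideal_sum I n (x : 'I_n -> R) :
  left_ideal I -> (forall i, I (x i)) -> I (\sum_(i < n) x i).
Proof.
move=> hI Ix; elim/big_ind: _ => [|y z Iy Iz|i _]; [exact: left_ideal0 | | exact: Ix].
exact: left_idealD.
Qed.

Lemma left_ideal_neq0 I : left_ideal I -> I <> [set 0] -> exists2 x, I x & x <> 0.
Proof.
move=> hI; apply: contra_notP => h; apply/seteqP; split=> [x Ix|_ ->] /=.
  by apply: contrapT => x0; apply: h; exists x.
exact: left_ideal0.
Qed.

Definition principal_left (a : R) : set R := [set x | exists r, x = r * a].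

Lemma principal_left_ideal a : left_ideal (principal_left a).
Proof.
split=> [|_ _ [r ->] [s ->]|b _ [r ->]]; first by exists 0; rewrite mul0r.
  by exists (r - s); rewrite mulrBl.
by exists (b * r); rewrite mulrA.
Qed.

Lemma principal_left_gen a : principal_left a a.
Proof. by exists 1; rewrite mul1r. Qed.

Lemma principal_left_sub I a : left_ideal I -> I a -> principal_left a `<=` I.
Proof. by move=> hI Ia _ [r ->]; exact: left_idealM. Qed.

Definition left_sum I J : set R := [set x | exists y z, [/\ I y, J z & x = y + z]].

Lemma left_sum_ideal I J : left_ideal I -> left_ideal J -> left_ideal (left_sum I J).
Proof.
move=> hI hJ; split=> [|_ _ [y [z [Iy Jz ->]]] [y' [z' [Iy' Jz' ->]]]|a _ [y [z [Iy Jz ->]]]].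
- by exists 0, 0; rewrite addr0; split=> //; exact: left_ideal0.
- exists (y - y'), (z - z'); split; [exact: left_idealB | exact: left_idealB |].
  by rewrite opprD addrACA.
- by exists (a * y), (a * z); rewrite mulrDr; split=> //; exact: left_idealM.
Qed.

Lemma left_sum_subl I J : left_ideal J -> I `<=` left_sum I J.
Proof. by move=> hJ x Ix; exists x, 0; rewrite addr0; split=> //; exact: left_ideal0. Qed.

Lemma left_sum_subr I J : left_ideal I -> J `<=` left_sum I J.
Proof. by move=> hI x Jx; exists 0, x; rewrite add0r; split=> //; exact: left_ideal0. Qed.

Lemma left_idealI I J : left_ideal I -> left_ideal J -> left_ideal (I `&` J).
Proof.
move=> hI hJ; split=> [|x y [Ix Jx] [Iy Jy]|a x [Ix Jx]]; first by split; exact: left_ideal0.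
  by split; exact: left_idealB.
by split; exact: left_idealM.
Qed.

Lemma left_annihilator_ideal (X : set R) : left_ideal (left_annihilator X).
Proof.
split=> [x _|x y hx hy z Xz|a x hx z Xz]; first by rewrite mul0r.
  by rewrite mulrBl hx // hy // subrr.
by rewrite -mulrA hx // mulr0.
Qed.

Definition right_annihilator (X : set R) : set R := [set r | forall x, X x -> x * r = 0].

Lemma left_right_left_annihilator (X : set R) :
  left_annihilator (right_annihilator (left_annihilator X)) = left_annihilator X.
Proof.
apply/seteqP; split=> [r hr x Xx|r hr x hx]; last exact: hx.
by apply: hr => s hs; exact: hs.
Qed.

Definition ann1 (a : R) : set R := left_annihilator [set a].

Lemma ann1E a r : ann1 a r <-> r * a = 0.
Proof. by split=> [h|h _ ->]; [exact: h|]. Qed.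

End LeftIdeals.

(** * Chains of sets and independent sequences *)
Section ChainLemmas.
Variable T : Type.
Implicit Types A : nat -> set T.

Lemma chain_le A : (forall n, A n `<=` A n.+1) ->
  forall m n, (m <= n)%N -> A m `<=` A n.
Proof.
move=> h m n /subnK <-; elim: (n - m)%N => [//|k IH] x /IH; rewrite addSn; exact: h.
Qed.

Lemma chain_ge A : (forall n, A n.+1 `<=` A n) ->
  forall m n, (m <= n)%N -> A n `<=` A m.
Proof.
move=> h m n /subnK <-; elim: (n - m)%N => [//|k IH] x; rewrite addSn => /h; exact: IH.
Qed.

(** A chain that never settles can be thinned out until no two consecutive
    terms agree; each remaining gap then supplies one nonzero summand of an
    infinite direct sum. *)
Lemma not_stationary A : ~ (exists N, forall n, (N <= n)%N -> A n = A N) ->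
  exists2 u : nat -> nat, (forall k, (u k <= u k.+1)%N) & forall k, A (u k) <> A (u k.+1).
Proof.
move=> h; have {}h N : exists n, (N <= n)%N /\ A n <> A N.
  apply: contrapT => hN; apply: h; exists N => n le_Nn.
  by apply: contrapT => hA; apply: hN; exists n.
have [g hg] := choice h; exists (fun k => iter k g 0%N) => k /=.
  by case: (hg (iter k g 0%N)).
by case: (hg (iter k g 0%N)) => _ /nesym.
Qed.

End ChainLemmas.

(** Dependent choice: without a maximal element one could step strictly upwards
    for ever. Stated for an arbitrary relation so as to serve ascending and
    descending chains alike. *)
Lemma maximal_of_chains (T : Type) (r : T -> T -> Prop) (G : set T) :
  (forall u : nat -> T, (forall n, G (u n)) -> (forall n, r (u n) (u n.+1)) ->
     exists n, u n.+1 = u n) ->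
  (exists A, G A) -> exists A, G A /\ forall B, G B -> r A B -> B = A.
Proof.
move=> hG [A0 GA0]; apply: contrapT => hmax.
have step (A : {A | G A}) : exists B : {A | G A}, r (sval A) (sval B) /\ sval B <> sval A.
  apply: contrapT => hA; apply: hmax; exists (sval A); split; first exact: svalP.
  move=> B GB AB; apply: contrapT => BA; apply: hA.
  by exists (exist _ B GB).
have [g hg] := choice step.
pose u n := iter n g (exist _ A0 GA0).
have [||N hN] := hG (fun n => sval (u n)).
- by move=> n; apply/svalP.
- by move=> n; case: (hg (u n)).
- by case: (hg (u N)).
Qed.

Lemma acc_maximal (R : nzRingType) (F G : set (set R)) : acc F -> G `<=` F ->
  (exists A, G A) -> exists A, G A /\ forall B, G B -> A `<=` B -> B = A.
Proof.
move=> hF GF; apply: maximal_of_chains => u Gu incu.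
by have [|//|N hN] := hF u; [move=> n; exact: GF | exists N; exact: hN].
Qed.

Lemma dcc_minimal (R : nzRingType) (F G : set (set R)) : dcc F -> G `<=` F ->
  (exists A, G A) -> exists A, G A /\ forall B, G B -> B `<=` A -> B = A.
Proof.
move=> hF GF; apply: (@maximal_of_chains _ (fun A B => B `<=` A)) => u Gu decu.
by have [|//|N hN] := hF u; [move=> n; exact: GF | exists N; exact: hN].
Qed.

Section Independence.
Variable R : nzRingType.
Implicit Types (A B : nat -> set R) (I : set R).

Definition no_infinite_direct_sum : Prop :=
  ~ exists A : nat -> set R,
      (forall n, left_ideal (A n) /\ A n <> [set 0]) /\ independent A.

(** The top term of a vanishing sum lies in the span of the lower ones, so it
    is zero; peel off terms from the top. *)
Lemma independent_ascending A B : (forall n, left_ideal (A n)) ->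
  (forall n, A n `<=` A n.+1) -> (forall n, B n `<=` A n.+1) ->
  (forall n x, B n x -> A n x -> x = 0) -> independent B.
Proof.
move=> hA incA BA disj; elim=> [x _ _ []//|n IH] x Bx.
rewrite big_ord_recr /= => hx.
have xA : A n (\sum_(i < n) x (widen_ord (leqnSn n) i)).
  apply: left_ideal_sum => // i.
  by apply: (chain_le incA (ltn_ord i)); apply: BA; exact: (Bx (widen_ord _ i)).
have xn0 : x ord_max = 0.
  apply: (disj n); first exact: (Bx ord_max).
  by rewrite -[x _]opprK -(addr0_eq hx); apply: left_idealN => //; rewrite opprK.
move: hx; rewrite xn0 addr0 => /(IH _ (fun i => Bx (widen_ord (leqnSn n) i))) hx i.
case: (unliftP ord_max i) => [j ->|-> //]; rewrite -[RHS](hx j).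
by congr x; apply: val_inj; rewrite /= /bump leqNgt ltn_ord.
Qed.

(** Here the bottom term of a vanishing sum lies in the span of the higher
    ones. Most infinite direct sums below arise in this way, from a descending
    chain. *)
Lemma independent_descending A B : (forall n, left_ideal (A n)) ->
  (forall n, A n.+1 `<=` A n) -> (forall n, B n `<=` A n) ->
  (forall n x, B n x -> A n.+1 x -> x = 0) -> independent B.
Proof.
move=> hA decA BA disj n.
elim: n A B hA decA BA disj => [|n IH] A B hA decA BA disj x Bx; first by move=> _ [].
rewrite big_ord_recl => hx.
have xA : A 1%N (\sum_(i < n) x (lift ord0 i)).
  apply: left_ideal_sum => // i.
  by apply: (@chain_ge _ A decA 1%N (lift ord0 i)) => //; apply: BA; exact: (Bx (lift ord0 i)).
have x00 : x ord0 = 0.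
  apply: (disj 0%N); first exact: (Bx ord0).
  by rewrite -[x _]opprK (addr0_eq hx); apply: left_idealN.
move: hx; rewrite x00 add0r => hx i.
case: (unliftP ord0 i) => [j ->|-> //].
apply: (IH (fun n => A n.+1) (fun n => B n.+1) _ _ _ _ (fun i => x (lift ord0 i))) => //.
- by move=> k; exact: disj.
- by move=> k; exact: (Bx (lift ord0 k)).
Qed.

Section Tails.
Variable A : nat -> set R.
Hypothesis hA : forall n, left_ideal (A n).

(** The internal sum of the [A i] with [n <= i]. Its elements are given by whole
    sequences with eventually constant partial sums, so that two of them can be
    subtracted without matching their lengths. *)
Definition tail_sum n : set R := [set x | exists y : nat -> R, exists M : nat,
  [/\ forall i, A i (y i), forall i, (i < n)%N -> y i = 0 &
      forall m, (M <= m)%N -> x = \sum_(i < m) y i]].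

Lemma tail_sum_ideal n : left_ideal (tail_sum n).
Proof.
split=> [|x x' [y [M [Ay y0 yx]]] [y' [M' [Ay' y'0 yx']]]|a x [y [M [Ay y0 yx]]]].
- exists (fun=> 0), 0%N; split=> // [i|m _]; first exact: left_ideal0.
  by rewrite big1.
- exists (fun i => y i - y' i), (maxn M M'); split=> [i|i lt_in|m].
  + exact: left_idealB.
  + by rewrite y0 // y'0 // subrr.
  + rewrite geq_max => /andP[hM hM'].
    by rewrite (yx m) // (yx' m) // -sumrB.
- exists (fun i => a * y i), M; split=> [i|i lt_in|m hM].
  + exact: left_idealM.
  + by rewrite y0 // mulr0.
  + by rewrite (yx m) // mulr_sumr.
Qed.

Lemma tail_sumS n : tail_sum n.+1 `<=` tail_sum n.
Proof.
move=> x [y [M [Ay y0 yx]]]; exists y, M; split=> // i lt_in; apply: y0.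
exact: ltnW.
Qed.

Lemma sub_tail_sum n : A n `<=` tail_sum n.
Proof.
move=> x Ax; exists (fun i => if i == n then x else 0), n.+1; split=> [i|i lt_in|m hm].
- by case: eqP => [->//|_]; exact: left_ideal0.
- by rewrite ltn_eqF.
- by rewrite -big_mkcond (big_pred1 (Ordinal hm)).
Qed.

Lemma tail_sum_sub n I : left_ideal I -> (forall i, A i `<=` I) -> tail_sum n `<=` I.
Proof.
move=> hI AI x [y [M [Ay _ yx]]]; rewrite (yx M) //; apply: left_ideal_sum => // i.
exact/AI/Ay.
Qed.

Hypothesis indA : independent A.

Lemma tail_sum_disjoint n x : A n x -> tail_sum n.+1 x -> x = 0.
Proof.
move=> Ax [y [M [Ay y0 yx]]]; pose z i := y i - (if i == n then x else 0).
pose m := maxn M n.+1.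
have lt_nm : (n < m)%N by rewrite leq_max leqnn orbT.
have Az (i : 'I_m) : A i (z i).
  by apply: left_idealB => //; case: eqP => [->//|_]; exact: left_ideal0.
have z0 : \sum_(i < m) z i = 0.
  rewrite sumrB -(yx m) ?leq_maxl // -big_mkcond (big_pred1 (Ordinal lt_nm)) //.
  exact: subrr.
have /= := indA Az z0 (Ordinal lt_nm).
by rewrite /z eqxx y0 // sub0r => /eqP; rewrite oppr_eq0 => /eqP.
Qed.

(** An element involves finitely many of the [A i]; once the tail starts beyond
    these, it meets the multiples of that element trivially. *)
Lemma tail_sum_bounded n x : tail_sum n x ->
  exists2 m, (n <= m)%N & forall r, tail_sum m (r * x) -> r * x = 0.
Proof.
move=> [y [M [Ay y0 yx]]]; exists (maxn M n); first exact: leq_maxr.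
move=> r [z [M' [Az z0 zx]]]; pose m := maxn M M'.
have lt_Mm : (M <= m)%N by rewrite leq_max leqnn.
have w0 : \sum_(i < m) (r * y i - z i) = 0.
  by rewrite sumrB -mulr_sumr -(yx m) // -(zx m) ?subrr // leq_max leqnn orbT.
rewrite (yx M) // mulr_sumr big1 // => i _.
have Aw (j : 'I_m) : A j (r * y j - z j).
  by apply: left_idealB => //; exact: left_idealM.
have := indA Aw w0 (widen_ord lt_Mm i).
by rewrite /= z0 ?subr0 // leq_max ltn_ord.
Qed.

Lemma independent_shift k : independent (fun n => A (k + n)%N).
Proof.
apply: (@independent_descending (fun n => tail_sum (k + n)%N)) => [n|n|n|n x].
- exact: tail_sum_ideal.
- by rewrite addnS; exact: tail_sumS.
- exact: sub_tail_sum.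
- by rewrite addnS; exact: tail_sum_disjoint.
Qed.

End Tails.

End Independence.

(** * Essential left ideals and complements *)
Section Essential.
Variable R : nzRingType.
Implicit Types (I J K E : set R).

(** Elementwise form of the condition that [E] meets every nonzero left ideal. *)
Definition essential E : Prop :=
  left_ideal E /\ forall x, x <> 0 -> exists r, r * x <> 0 /\ E (r * x).

Lemma essential_preimage E r : essential E -> essential [set x | E (x * r)].
Proof.
move=> [hE essE]; split.
  split=> [|x y Ex Ey|a x Ex] /=; first by rewrite mul0r; exact: left_ideal0.
    by rewrite mulrBl; exact: left_idealB.
  by rewrite -mulrA; exact: left_idealM.
move=> x x0; have [xr0|/essE[s [sxr0 Esxr]]] := EM (x * r = 0).
  by exists 1; rewrite /= mul1r xr0; split=> //; exact: left_ideal0.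
exists s; rewrite /= -mulrA; split=> // sx0.
by apply: sxr0; rewrite mulrA sx0 mul0r.
Qed.

Lemma essentialS E J : left_ideal J -> E `<=` J -> essential E -> essential J.
Proof.
by move=> hJ EJ [_ essE]; split=> // x /essE[r [rx0 Erx]]; exists r; split=> //; exact: EJ.
Qed.

Lemma not_essential E : left_ideal E -> ~ essential E ->
  exists2 x, x <> 0 & forall r, E (r * x) -> r * x = 0.
Proof.
move=> hE; apply: contra_notP => h; split=> // x x0.
apply: contrapT => hx; apply: h; exists x => // r Erx.
by apply: contrapT => rx0; apply: hx; exists r.
Qed.

Definition stable_subgroup (U : set (R -> R)) (K : set R) : Prop :=
  [/\ K 0, forall x y, K x -> K y -> K (x - y) & forall u x, U u -> K x -> K (u x)].

(** Zorn's lemma for left ideals and for two-sided ideals at once, according to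
    the multiplications gathered in [U]. *)
Lemma maximal_stable_subgroup (U : set (R -> R)) (D : set R) :
  (forall u, U u -> u 0 = 0) -> ~ D 0 ->
  exists K, [/\ stable_subgroup U K, forall x, K x -> ~ D x &
    forall L, stable_subgroup U L -> K `<=` L -> (forall x, L x -> ~ D x) -> L = K].
Proof.
move=> U0 D0.
pose P (K : set R) := [/\ forall x y, K x -> K y -> K (x - y),
  forall u x, U u -> K x -> K (u x) & forall x, K x -> ~ D x].
(* The condition [K 0] is left out of [P]: the union of the empty chain has to
   satisfy [P], and a maximal [K] contains [0] anyway. *)
have [|K [[KB KU KD] maxK]] := @Zorn_bigcup R P.
  move=> F FP totF; split=> [x y [A FA Ax] [B FB By]|u x Uu [A FA Ax]|x [A FA Ax]].
  - have [AB|BA] := totF _ _ FA FB.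
      by exists B => //; have [h _ _] := FP _ FB; apply: h => //; exact: AB.
    by exists A => //; have [h _ _] := FP _ FA; apply: h => //; exact: BA.
  - by exists A => //; have [_ h _] := FP _ FA; exact: h.
  - by have [_ _ h] := FP _ FA; exact: h.
have K0 : K 0.
  apply: contrapT => K0; apply: (maxK [set 0]).
    split=> [x Kx|K0']; last by apply: K0; exact: K0'.
    by case: K0; rewrite -[0](subrr x); exact: KB.
  by split=> [_ _ -> ->|u _ Uu ->|_ ->] //=; [rewrite subrr | exact: U0].
exists K; split=> // L [L0 LB LU] KL LD; apply: contrapT => LK.
by apply: (maxK L); split=> // LK'; apply: LK; apply/seteqP.
Qed.

(** A maximal [K] among the left ideals that meet [J] trivially: if [J + K] met
    some nonzero cyclic left ideal trivially, this one could be added to [K]. *)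
Lemma left_complement J : left_ideal J -> exists K,
  [/\ left_ideal K, forall x, J x -> K x -> x = 0 & essential (left_sum J K)].
Proof.
move=> hJ.
pose U : set (R -> R) := [set u | exists a, forall x, u x = a * x].
have stableP K : stable_subgroup U K <-> left_ideal K.
  split=> -[K0 KB KM]; split=> //; last by move=> u x [a ->] Kx; exact: KM.
  by move=> a x Kx; apply: (KM ( *%R a)) => //; exists a.
have [|/=|K [/stableP hK disj maxK]] := @maximal_stable_subgroup U [set x | J x /\ x <> 0].
- by move=> u [a ->]; rewrite mulr0.
- by case.
exists K; split=> // [x Jx Kx|]; first by apply: contrapT => x0; exact: (disj x).
have hS := left_sum_ideal hJ hK; apply: contrapT => /(not_essential hS)[x x0 hx].
have hL := left_sum_ideal hK (principal_left_ideal x).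
suff LK : left_sum K (principal_left x) = K.
  have Kx : K x by rewrite -LK; apply: left_sum_subr => //; exact: principal_left_gen.
  by apply: x0; rewrite -[x]mul1r; apply: hx; rewrite mul1r; exact: left_sum_subr.
apply: maxK; first exact/stableP.
  exact: left_sum_subl (principal_left_ideal x).
move=> _ [k [_ [Kk [r ->] ->]]] [Jkr kr0].
have rx0 : r * x = 0.
  apply: hx; exists (k + r * x), (- k); split=> //; first exact: left_idealN.
  by rewrite addrAC subrr add0r.
by apply: (disj k) => //; move: Jkr kr0; rewrite rx0 addr0.
Qed.

(** The form in which semisimplicity is used: it makes every left ideal a direct
    summand, and for a left quotient ring of [R] it amounts to essential left ideals
    of [R] containing regular elements. *)
Definition no_proper_essential : Prop := forall E, essential E -> E 1.

(** The trace on [B] of a complement of [A], by the modular law. *)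
Lemma relative_complement (A B : set R) :
  no_proper_essential -> left_ideal A -> left_ideal B -> A `<=` B -> A <> B ->
  exists C, [/\ left_ideal C, C <> [set 0], C `<=` B &
    forall x, C x -> A x -> x = 0].
Proof.
move=> npe hA hB AB neqAB; have [K [hK disj /npe [a [k [Aa Kk e1]]]]] := left_complement hA.
exists (B `&` K); split; last 2 first.
- by move=> x [].
- by move=> x [_ Kx] Ax; exact: disj.
- exact: left_idealI.
move=> BK0; apply: neqAB; apply/seteqP; split=> // b Bb.
have hb : b = b * a + b * k by rewrite -mulrDr -e1 mulr1.
have bk0 : [set 0] (b * k).
  rewrite -BK0; split; last exact: left_idealM.
  have -> : b * k = b - b * a by rewrite {2}hb addrAC subrr add0r.
  by apply: left_idealB => //; apply: AB; exact: left_idealM.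
by rewrite hb bk0 addr0; exact: left_idealM.
Qed.

Lemma left_ideals_acc : no_proper_essential -> no_infinite_direct_sum R ->
  acc (@left_ideal R).
Proof.
move=> npe nis A hA incA; apply: contrapT => /not_stationary[u leu neu].
have /choice[B hB] : forall k, exists C, [/\ left_ideal C, C <> [set 0], C `<=` A (u k.+1) &
    forall x, C x -> A (u k) x -> x = 0].
  by move=> k; apply: relative_complement => //; exact: (chain_le incA).
apply: nis; exists B; split=> [n|]; first by case: (hB n).
apply: (@independent_ascending _ (fun k => A (u k))) => // n.
- exact: (chain_le incA).
- by case: (hB n).
- by case: (hB n).
Qed.

Lemma left_ideals_dcc : no_proper_essential -> no_infinite_direct_sum R ->
  left_artinian R.
Proof.
move=> npe nis A hA decA; apply: contrapT => /not_stationary[u leu neu].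
have /choice[B hB] : forall k, exists C, [/\ left_ideal C, C <> [set 0], C `<=` A (u k) &
    forall x, C x -> A (u k.+1) x -> x = 0].
  move=> k; apply: relative_complement => //; first exact: (chain_ge decA).
  exact/nesym.
apply: nis; exists B; split=> [n|]; first by case: (hB n).
apply: (@independent_descending _ (fun k => A (u k))) => // n.
- exact: (chain_ge decA).
- by case: (hB n).
- by case: (hB n).
Qed.

(** An essential left ideal meets every minimal left ideal, hence contains it. *)
Lemma semisimple_no_proper_essential : left_semisimple R -> no_proper_essential.
Proof.
move=> ss E [hE essE]; have [n [y [hy ->]]] := ss 1.
apply: left_ideal_sum => // i; have [I [hI I0 minI] Iyi] := hy i.
have [z Iz z0] := left_ideal_neq0 hI I0.
have [r [rz0 Erz]] := essE z z0.
have [EI0|EII] := minI _ (left_idealI hE hI) (@subIsetr _ _ _).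
  by case: rz0; have : [set 0] (r * z) by rewrite -EI0; split=> //; exact: left_idealM.
by have [] : (E `&` I) (y i) by rewrite EII.
Qed.

Definition left_socle : set R :=
  [set x | exists (n : nat) (y : 'I_n -> R),
    (forall i, exists2 I, minimal_left_ideal I & I (y i)) /\ x = \sum_(i < n) y i].

Lemma left_socle_ideal : left_ideal left_socle.
Proof.
have scale a x : left_socle x -> left_socle (a * x).
  move=> [n [y [hy ->]]]; exists n, (fun i => a * y i); rewrite mulr_sumr; split=> // i.
  by have [I mI Iy] := hy i; exists I => //; apply: left_idealM => //; case: mI.
split=> [|x x' [n [y [hy ->]]] /(scale (-1))[n' [y' [hy' e']]]|//].
  by exists 0%N, (fun=> 0); rewrite big_ord0; split=> // -[].
exists (n + n')%N, (fun i => match fintype.split i with inl j => y j | inr j => y' j end).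
split=> [i|]; first by case: (fintype.split i).
rewrite big_split_ord /= -mulN1r e'; congr (_ + _); apply: eq_bigr => i _.
  by rewrite -[lshift _ i]/(unsplit (inl i)) unsplitK.
by rewrite -[rshift _ i]/(unsplit (inr i)) unsplitK.
Qed.

(** A complement of the socle, if nonzero, would contain a minimal left ideal by
    the descending chain condition, and this one would lie in the socle. *)
Lemma no_proper_essential_semisimple : no_proper_essential ->
  no_infinite_direct_sum R -> semisimple_artinian R.
Proof.
move=> npe nis; have art := left_ideals_dcc npe nis; split=> // x.
apply: contrapT => /= notx.
have [||||C [hC C0 _ disj]] := @relative_complement left_socle setT npe.
- exact: left_socle_ideal.
- by [].
- by [].
- by move=> e; apply: notx; have : setT x by []; rewrite -e.
pose G : set (set R) := [set I | [/\ left_ideal I, I <> [set 0] & I `<=` C]].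
have [||I [[hI I0 IC] minI]] := dcc_minimal (G := G) art.
- by move=> I [].
- by exists C; split.
have [z Iz z0] := left_ideal_neq0 hI I0; apply: z0; apply: (disj); first exact: IC.
exists 1%N, (fun=> z); rewrite big_ord1; split=> // _; exists I => //; split=> // J hJ JI.
have [J0|J0] := EM (J = [set 0]); [by left | right].
by apply: minI => //; split=> //; exact: subset_trans JI IC.
Qed.

End Essential.

(** * Regular elements in essential left ideals *)
Section Goldie.
Variable R : nzRingType.
Implicit Types (I J E : set R) (a b c r x : R).

(** The nilpotent ideal is taken inside the two-sided ideal [K] of all [x] with
    [x R a = 0], as the part of it killed by [K R] on the left: this
    contains [a] and squares to zero. Unlike the ideal generated by [a], it is
    described without finite sums of products. *)
Lemma semiprime_elem a : semiprime_ring R -> (forall r, a * r * a = 0) -> a = 0.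
Proof.
move=> spR aRa.
pose K : set R := [set x | forall r, x * r * a = 0].
pose I : set R := [set x | K x /\ forall y, K y -> forall r, y * r * x = 0].
have nilI : nilpotent_ideal I.
  split; last first.
    exists 2%N => x Ix; rewrite !big_ord_recr big_ord0 /= mul1r.
    have [Kx _] := Ix (widen_ord (leqnSn 1) ord_max); have [_ hx] := Ix ord_max.
    by rewrite -[X in X * _]mulr1; exact: hx.
  split; first split.
  - by split=> [r|y _ r]; rewrite ?mul0r ?mulr0.
  - move=> x y [Kx hx] [Ky hy]; split=> [r|z Kz r]; first by rewrite !mulrBl Kx Ky subrr.
    by rewrite mulrBr hx // hy // subrr.
  - move=> r x [Kx hx]; split=> [s|z Kz s]; first by rewrite -2!mulrA [x * _]mulrA Kx mulr0.
    by rewrite mulrA -(mulrA z) hx.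
  - move=> x r [Kx hx]; split=> [s|z Kz s]; first by rewrite -(mulrA x) Kx.
    by rewrite mulrA hx // mul0r.
have : I a by split.
by rewrite (spR I nilI).
Qed.

Lemma ann1_range a : range (@left_annihilator R) (ann1 a).
Proof. by exists [set a]. Qed.

(** In a nil left ideal choose [b] nonzero with maximal left
    annihilator. If [b r b] were nonzero, let [b (r b) ^ n] be the last
    nonzero term of its sequence: its annihilator contains that of [b], hence is equal
    to it, and it contains [b r]. So [b R b = 0]. *)
Lemma nil_left_ideal_eq0 a : semiprime_ring R -> acc (range (@left_annihilator R)) ->
  (forall r, exists n, (r * a) ^+ n = 0) -> a = 0.
Proof.
move=> spR accR nila; apply: contrapT => a0.
pose G : set (set R) := [set ann1 b | b in [set b | principal_left a b /\ b <> 0]].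
have [||_ [[b [Rab b0] <-] maxb]] := acc_maximal (G := G) accR.
- by move=> _ [b _ <-]; exact: ann1_range.
- by exists (ann1 a), a => //; split=> //; exact: principal_left_gen.
apply/b0/semiprime_elem => // r; apply: contrapT => brb0.
have exn : exists n, b * (r * b) ^+ n == 0.
  have [s e] := Rab; have [n hn] := nila (r * s).
  by exists n; rewrite e mulrA hn mulr0.
case: (ex_minnP exn) => -[|n]; first by rewrite mulr1 => /eqP.
move=> /eqP hn minn.
have xn0 : b * (r * b) ^+ n <> 0 by move=> /eqP /minn; rewrite ltnn.
apply: brb0; apply/ann1E; rewrite -(maxb (ann1 (b * (r * b) ^+ n))).
- by apply/ann1E; move: hn; rewrite exprS !mulrA.
- exists (b * (r * b) ^+ n) => //; split=> //.
  case: n {minn xn0} hn => [_|n _]; first by rewrite mulr1.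
  rewrite exprSr !mulrA; apply: left_idealM => //; exact: principal_left_ideal.
- by move=> x /ann1E xb; apply/ann1E; rewrite mulrA xb mul0r.
Qed.

Lemma ann1_pow_stationary (w : R) : acc (range (@left_annihilator R)) ->
  exists N, forall n x, (N <= n)%N -> x * w ^+ n = 0 -> x * w ^+ N = 0.
Proof.
move=> accR; have [|n x|N hN] := accR (fun n => ann1 (w ^+ n)).
- by move=> n; exact: ann1_range.
- by move=> /ann1E h; apply/ann1E; rewrite exprSr mulrA h mul0r.
- by exists N => n x /hN hn /ann1E; rewrite hn => /ann1E.
Qed.

(** Each [w = r z] again has an essential annihilator, which meets [R w ^ N] if
    [w ^ N] is nonzero; for [N] from which on the annihilators of the powers of [w]
    are stationary this is absurd. So [R z] is nil. *)
Lemma left_nonsingular (z : R) : semiprime_ring R -> acc (range (@left_annihilator R)) ->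
  essential (ann1 z) -> z = 0.
Proof.
move=> spR accR essz; apply: nil_left_ideal_eq0 => // r.
have [N hN] := ann1_pow_stationary (r * z) accR.
exists N; apply: contrapT => wN0.
have [_ /(_ _ wN0)[s [swN0 /= ]]] := essential_preimage r essz.
move=> /ann1E h; apply: swN0; apply: (hN N.+1) => //.
by rewrite exprSr !mulrA.
Qed.

(** A high power [b] of a non-nilpotent element of [I]: the annihilators of its
    powers are stationary, so [R b] meets the annihilator of [b] trivially. *)
Lemma left_ideal_nondegenerate I a : semiprime_ring R -> acc (range (@left_annihilator R)) ->
  left_ideal I -> I a -> a <> 0 ->
  exists b, [/\ I b, b <> 0 & forall x, x * b * b = 0 -> x * b = 0].
Proof.
move=> spR accR hI Ia a0.
have [r hr] : exists r, forall n, (r * a) ^+ n <> 0.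
  apply: contrapT => h; apply: a0; apply: nil_left_ideal_eq0 => // r.
  by apply: contrapT => hr; apply: h; exists r => n hn; apply: hr; exists n.
have [N hN] := ann1_pow_stationary (r * a) accR.
exists ((r * a) ^+ N.+1); split=> // [|x].
  by rewrite exprSr mulrA; exact: left_idealM.
rewrite -mulrA -exprD => /hN h; rewrite exprSr mulrA h ?mul0r //.
by rewrite addSn -addnS leq_addr.
Qed.

(** Start from [c = 0] and, as long as the annihilator of [c] meets [E], replace
    [c] by [c + a] with [a] nondegenerate in that intersection. Since [a c = 0],
    the new annihilator is the intersection of those of [c] and [a]; the left
    ideals [R a] thus obtained are independent, so the process stops. *)
Lemma essential_left_regular E : semiprime_ring R -> acc (range (@left_annihilator R)) ->
  no_infinite_direct_sum R -> essential E -> exists2 c, E c & forall x, x * c = 0 -> x = 0.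
Proof.
move=> spR accR nis [hE essE].
pose P : set R := [set c | E c /\ forall x, x * c * c = 0 -> x * c = 0].
have [[c [Ec hc] term]|] := EM (exists2 c, P c & forall a, E a -> a * c = 0 -> a = 0).
  exists c => // x xc; apply: contrapT => /essE[r [rx0 Erx]]; apply: rx0.
  by apply: term => //; rewrite -mulrA xc mulr0.
move=> noterm; exfalso.
have step (c : {c | P c}) : exists a, [/\ E a, a <> 0, a * sval c = 0 &
    forall x, x * a * a = 0 -> x * a = 0].
  case: c => c [Ec hc] /=.
  have [b [[Eb bc] b0]] : exists b, (E `&` ann1 c) b /\ b <> 0.
    apply: contrapT => h; apply: noterm; exists c => // a Ea ac.
    by apply: contrapT => a0; apply: h; exists a; split=> //; split=> //; exact/ann1E.
  have [a [[Ea /ann1E ac] a0 ha]] := left_ideal_nondegenerate spR accR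
    (left_idealI hE (left_annihilator_ideal _)) (conj Eb bc) b0.
  by exists a.
have [g hg] := choice step.
have ann_add (c : {c | P c}) x : x * (sval c + g c) = 0 -> x * sval c = 0 /\ x * g c = 0.
  have [_ _ gc hgc] := hg c; have [_ hc] := svalP c; move=> e.
  have xc : x * sval c = 0.
    apply: hc; have := congr1 ( *%R^~ (sval c)) e.
    by rewrite /= mul0r mulrDr mulrDl -[x * g c * _]mulrA gc mulr0 addr0.
  by split=> //; move: e; rewrite mulrDr xc add0r.
have Pnext (c : {c | P c}) : P (sval c + g c).
  have [Eg _ gc hgc] := hg c; have [Ec hc] := svalP c.
  split=> [|x e]; first exact: left_idealD.
  have [e1 e2] := ann_add c _ e.
  have e1' : x * sval c * sval c = 0.
    by move: e1; rewrite mulrDr mulrDl -[x * g c * _]mulrA gc mulr0 addr0.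
  have xc := hc _ e1'; rewrite mulrDr xc add0r.
  by apply: hgc; move: e2; rewrite mulrDr xc add0r.
pose next (c : {c | P c}) : {c | P c} := exist _ (sval c + g c) (Pnext c).
have P0 : P 0 by split=> [|x _]; [exact: left_ideal0 | rewrite mulr0].
pose u n := iter n next (exist _ 0 P0).
apply: nis; exists (fun n => principal_left (g (u n))); split=> [n|].
  split; first exact: principal_left_ideal.
  have [_ g0 _ _] := hg (u n); move=> e; apply: g0.
  have : principal_left (g (u n)) (g (u n)) by exact: principal_left_gen.
  by rewrite e.
apply: (@independent_descending _ (fun n => ann1 (sval (u n)))) => [n|n x|n|n _ [r ->]].
- exact: left_annihilator_ideal.
- by move=> /ann1E /ann_add[h _]; apply/ann1E.
- move=> _ [r ->]; apply/ann1E; have [_ _ h _] := hg (u n).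
  by rewrite -mulrA h mulr0.
- move=> /ann1E /ann_add[_]; have [_ _ _] := hg (u n); exact.
Qed.

(** If [x] is nonzero and [R x] meets [R c] trivially, then the [R x c ^ n] are
    nonzero and independent. *)
Lemma principal_left_essential c : no_infinite_direct_sum R ->
  (forall x, x * c = 0 -> x = 0) -> essential (principal_left c).
Proof.
move=> nis hc; apply: contrapT => /(not_essential (principal_left_ideal c))[x x0 hx].
have hcn n : forall y, y * c ^+ n = 0 -> y = 0.
  by elim: n => [|n IH] y; [rewrite mulr1 | rewrite exprSr mulrA => /hc /IH].
apply: nis; exists (fun n => principal_left (x * c ^+ n)); split=> [n|].
  split; first exact: principal_left_ideal.
  move=> e; apply: x0; apply: (hcn n).
  have : principal_left (x * c ^+ n) (x * c ^+ n) by exact: principal_left_gen.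
  by rewrite e.
apply: (@independent_descending _ (fun n => principal_left (c ^+ n))) => [n|n|n|n].
- exact: principal_left_ideal.
- by move=> _ [r ->]; exists (r * c); rewrite exprS mulrA.
- by move=> _ [r ->]; exists (r * x); rewrite mulrA.
- move=> _ [r ->] [s e].
  have rx : r * x = s * c.
    apply/eqP; rewrite -subr_eq0; apply/eqP; apply: (hcn n).
    by rewrite mulrBl -mulrA e exprS mulrA subrr.
  by rewrite mulrA hx ?mul0r //; exists s.
Qed.

Lemma regular_elementsP c : @regular_elements R c <->
  (forall x, c * x = 0 -> x = 0) /\ (forall x, x * c = 0 -> x = 0).
Proof.
split=> [[lc rc]|[lc rc]]; split.
- by move=> x e; apply: lc; rewrite e mulr0.
- by move=> x e; apply: rc; rewrite e mul0r.
- exact: mulrI0_lreg.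
- exact: mulIr0_rreg.
Qed.

Lemma essential_regular E : semiprime_ring R -> left_goldie R -> essential E ->
  exists2 c, E c & @regular_elements R c.
Proof.
move=> spR [accR nis] essE.
have [c Ec hc] := essential_left_regular spR accR nis essE.
exists c => //; apply/regular_elementsP; split=> // x cx.
apply: left_nonsingular => //.
apply: essentialS (principal_left_essential nis hc); first exact: left_annihilator_ideal.
by move=> _ [r ->]; apply/ann1E; rewrite -mulrA cx mulr0.
Qed.

Lemma goldie_ore : semiprime_ring R -> left_goldie R -> left_ore (@regular_elements R).
Proof.
move=> spR gR r c /regular_elementsP[_ hc]; have [_ nis] := gR.
have essc := essential_preimage r (principal_left_essential nis hc).
have [c' [r' e] Cc'] := essential_regular spR gR essc.
by exists c', r'.
Qed.

End Goldie.

(** * The ring of left fractions *)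
Section FractionGraphs.
Variable R : nzRingType.
Local Notation C := (@regular_elements R).
Implicit Types (F G H : R -> R -> Prop) (c x y z : R).

Lemma regular1 : C 1.
Proof. by split=> x y; rewrite ?mul1r ?mulr1. Qed.

Lemma regularM c d : C c -> C d -> C (c * d).
Proof. by case=> lc rc [ld rd]; split; [exact: lregM | exact: rregM]. Qed.

Lemma regular_mull_eq0 c x : C c -> c * x = 0 -> x = 0.
Proof. by move=> /regular_elementsP[h _]; exact: h. Qed.

Lemma regular_mulr_eq0 c x : C c -> x * c = 0 -> x = 0.
Proof. by move=> /regular_elementsP[_ h]; exact: h. Qed.

Definition prefraction F : Prop :=
  [/\ forall x y x' y', F x y -> F x' y' -> F (x - x') (y - y'),
      forall a x y, F x y -> F (a * x) (a * y),
      forall y, F 0 y -> y = 0 &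
      exists c y, C c /\ F c y].

(** A fraction [q] is encoded by the graph of right multiplication by [q], that
    is, the set of pairs [(x, y)] with [x q = y]. Such a graph is a submodule of
    [R * R], functional, with a regular element in its domain, and saturated: it
    contains [(x, y)] as soon as it contains [(c x, c y)] with [c] regular.
    Thus equality of fractions is equality of graphs, and no quotient by an
    equivalence of pairs is needed. *)
Definition saturation F : R -> R -> Prop :=
  fun x y => exists2 c, C c & F (c * x) (c * y).

Definition fraction_graph F : Prop :=
  prefraction F /\ forall c x y, C c -> F (c * x) (c * y) -> F x y.

Hypothesis ore : left_ore C.

Lemma fraction_domain F x : prefraction F -> exists c y, C c /\ F (c * x) y.
Proof.
move=> [_ FM _ [d [e [Cd Fde]]]]; have [c [r [Cc e1]]] := ore x Cd.
by exists c, (r * e); split=> //; rewrite e1; exact: FM.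
Qed.

Lemma saturationP F : prefraction F -> fraction_graph (saturation F).
Proof.
move=> [FB FM F0 [d [e [Cd Fde]]]]; split; first split.
- move=> x y x' y' [c Cc Fc] [c' Cc' Fc'].
  have [u [v [Cu e1]]] := ore c Cc'; exists (u * c); first exact: regularM.
  by rewrite !mulrBr; apply: FB; [rewrite -!mulrA | rewrite e1 -!mulrA]; exact: FM.
- move=> a x y [c Cc Fc]; have [u [v [Cu e1]]] := ore a Cc.
  by exists u => //; rewrite !mulrA e1 -!mulrA; exact: FM.
- by move=> y [c Cc]; rewrite mulr0 => /F0; exact: regular_mull_eq0.
- by exists d, e; split=> //; exists 1; [exact: regular1 | rewrite !mul1r].
- move=> c x y Cc [c' Cc']; rewrite !mulrA => h.
  by exists (c' * c) => //; exact: regularM.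
Qed.

Lemma saturationI F x y : F x y -> saturation F x y.
Proof. by exists 1; [exact: regular1 | rewrite !mul1r]. Qed.

(** A fraction is determined by its value at one regular element; all the ring
    identities below are checked at a common denominator. *)
Lemma fraction_graph_ext F G c y : fraction_graph F -> fraction_graph G ->
  C c -> F c y -> G c y -> F = G.
Proof.
suff sub F' G' : fraction_graph F' -> fraction_graph G' -> C c -> F' c y -> G' c y ->
    forall x z, F' x z -> G' x z.
  by move=> hF hG Cc Fc Gc; apply/funext => x; apply/funext => z; apply/propext; split; exact: sub.
move=> [[FB FM F0 _] _] [[_ GM _ _] Gsat] Cc Fc Gc x z Fxz.
have [u [v [Cu e]]] := ore x Cc; apply: (Gsat u) => //.
suff -> : u * z = v * y by rewrite e; exact: GM.
apply/eqP; rewrite -subr_eq0; apply/eqP/F0.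
have -> : 0 = u * x - v * c by rewrite e subrr.
by apply: FB; exact: FM.
Qed.

Definition add_graph F G : R -> R -> Prop :=
  saturation (fun x z => exists y y', [/\ F x y, G x y' & z = y + y']).

(** Right multiplication by a product is a composition, in this order. *)
Definition mul_graph F G : R -> R -> Prop :=
  saturation (fun x z => exists2 y, F x y & G y z).

Definition opp_graph F : R -> R -> Prop := fun x y => F x (- y).

Definition const_graph (r : R) : R -> R -> Prop := fun x y => y = x * r.

Lemma add_graphP F G : prefraction F -> prefraction G -> fraction_graph (add_graph F G).
Proof.
move=> hF hG; apply: saturationP.
have [FB FM F0 [c [y [Cc Fc]]]] := hF; have [GB GM G0 _] := hG; split.
- move=> x z x' z' [u [v [Fu Gv ->]]] [u' [v' [Fu' Gv' ->]]].
  by exists (u - u'), (v - v'); split; [exact: FB | exact: GB | rewrite opprD addrACA].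
- move=> a x z [u [v [Fu Gv ->]]].
  by exists (a * u), (a * v); split; [exact: FM | exact: GM | rewrite mulrDr].
- by move=> z [u [v [/F0 -> /G0 -> ->]]]; rewrite addr0.
- have [d [y' [Cd Gd]]] := fraction_domain c hG.
  exists (d * c), (d * y + y'); split; first exact: regularM.
  by exists (d * y), y'; split=> //; exact: FM.
Qed.

Lemma mul_graphP F G : prefraction F -> prefraction G -> fraction_graph (mul_graph F G).
Proof.
move=> hF hG; apply: saturationP.
have [FB FM F0 [c [y [Cc Fc]]]] := hF; have [GB GM G0 _] := hG; split.
- by move=> x z x' z' [u Fu Gu] [u' Fu' Gu']; exists (u - u'); [exact: FB | exact: GB].
- by move=> a x z [u Fu Gu]; exists (a * u); [exact: FM | exact: GM].
- by move=> z [u /F0 -> /G0].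
- have [d [z [Cd Gd]]] := fraction_domain y hG.
  exists (d * c), z; split; first exact: regularM.
  by exists (d * y) => //; exact: FM.
Qed.

Lemma opp_graphP F : fraction_graph F -> fraction_graph (opp_graph F).
Proof.
move=> [[FB FM F0 [d [e [Cd Fd]]]] Fsat]; split; first split.
- by move=> x y x' y' h h'; rewrite /opp_graph opprD; exact: FB.
- by move=> a x y h; rewrite /opp_graph -mulrN; exact: FM.
- by move=> y /F0/eqP; rewrite oppr_eq0 => /eqP.
- by exists d, (- e); rewrite /opp_graph opprK.
- by move=> c x y Cc; rewrite /opp_graph -mulrN; exact: Fsat.
Qed.

Lemma const_graphP r : fraction_graph (const_graph r).
Proof.
split; first split.
- by move=> x y x' y' -> ->; rewrite /const_graph mulrBl.
- by move=> a x y ->; rewrite /const_graph mulrA.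
- by move=> y ->; rewrite mul0r.
- by exists 1, r; split; [exact: regular1 | rewrite /const_graph mul1r].
- by move=> c x y [lc _]; rewrite /const_graph -mulrA => /lc.
Qed.

(** The graph of right multiplication by the inverse of [c]. *)
Definition inv_graph (c : R) : R -> R -> Prop := fun x y => x = y * c.

Lemma inv_graphP c : C c -> fraction_graph (inv_graph c).
Proof.
move=> Cc; split; first split.
- by move=> x y x' y' -> ->; rewrite /inv_graph mulrBl.
- by move=> a x y ->; rewrite /inv_graph mulrA.
- by move=> y e; apply: (regular_mulr_eq0 Cc).
- by exists c, 1; split=> //; rewrite /inv_graph mul1r.
- by move=> d x y [ld _]; rewrite /inv_graph -mulrA => /ld.
Qed.

End FractionGraphs.

Section FractionRing.
Variable R : nzRingType.
Local Notation C := (@regular_elements R).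
Variable ore : left_ore C.

Record left_fractions := LeftFraction {
  graph_of :> R -> R -> Prop;
  graph_ofP : fraction_graph graph_of }.

(** The alias carries the Ore condition, on which the ring structure depends. *)
Definition fraction_ring of left_ore C : Type := left_fractions.

HB.instance Definition _ := gen_eqMixin (fraction_ring ore).
HB.instance Definition _ := gen_choiceMixin (fraction_ring ore).
Implicit Types (p q s : left_fractions) (c x y z : R).

Let preP q : prefraction q. Proof. by case: (graph_ofP q). Qed.

Lemma fraction_ext p q c y : C c -> p c y -> q c y -> p = q.
Proof.
move=> Cc pc qc; have := fraction_graph_ext ore (graph_ofP p) (graph_ofP q) Cc pc qc.
by case: p q {pc qc} => F hF [G hG] /= e; subst G; rewrite (Prop_irrelevance hF hG).
Qed.

Lemma fractionM q a x y : q x y -> q (a * x) (a * y).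
Proof. by have [_ h _ _] := preP q; exact: h. Qed.

Lemma fraction_denom q : exists c y, C c /\ q c y.
Proof. by have [_ _ _ h] := preP q. Qed.

Lemma fraction_denom2 q p : exists c y z, [/\ C c, q c y & p c z].
Proof.
have [c [y [Cc qy]]] := fraction_denom q.
have [d [z [Cd pz]]] := fraction_domain ore c (preP p).
exists (d * c), (d * y), z; split=> //; [exact: regularM | exact: fractionM].
Qed.

Lemma fraction_denom3 q p s : exists c y z t, [/\ C c, q c y, p c z & s c t].
Proof.
have [c [y [z [Cc qy pz]]]] := fraction_denom2 q p.
have [d [t [Cd st]]] := fraction_domain ore c (preP s).
exists (d * c), (d * y), (d * z), t; split=> //; first exact: regularM.
  exact: fractionM.
exact: fractionM.
Qed.

Definition fraction_add p q := LeftFraction (add_graphP ore (preP p) (preP q)).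
Definition fraction_mul p q := LeftFraction (mul_graphP ore (preP p) (preP q)).
Definition fraction_opp p := LeftFraction (opp_graphP (graph_ofP p)).
Definition fraction_const r := LeftFraction (const_graphP r).

Lemma fraction_addI p q x y z : p x y -> q x z -> fraction_add p q x (y + z).
Proof. by move=> px qx; apply: saturationI; exists y, z. Qed.

Lemma fraction_mulI p q x y z : p x y -> q y z -> fraction_mul p q x z.
Proof. by move=> px qy; apply: saturationI; exists y. Qed.

Lemma fraction_constI r x : fraction_const r x (x * r).
Proof. by []. Qed.

Lemma fraction_addA : associative fraction_add.
Proof.
move=> p q s; have [c [y [z [t [Cc py qz st]]]]] := fraction_denom3 p q s.
apply: (fraction_ext (c := c) (y := y + z + t)) => //.
  by rewrite -addrA; apply: fraction_addI => //; exact: fraction_addI.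
by apply: fraction_addI => //; exact: fraction_addI.
Qed.

Lemma fraction_addC : commutative fraction_add.
Proof.
move=> p q; have [c [y [z [Cc py qz]]]] := fraction_denom2 p q.
apply: (fraction_ext (c := c) (y := y + z)) => //; first exact: fraction_addI.
by rewrite addrC; exact: fraction_addI.
Qed.

Lemma fraction_add0 : left_id (fraction_const 0) fraction_add.
Proof.
move=> p; have [c [y [Cc py]]] := fraction_denom p.
apply: (fraction_ext (c := c) (y := 0 + y)) => //; last by rewrite add0r.
by apply: fraction_addI => //; rewrite /= /const_graph mulr0.
Qed.

Lemma fraction_addN : left_inverse (fraction_const 0) fraction_opp fraction_add.
Proof.
move=> p; have [c [y [Cc py]]] := fraction_denom p.
apply: (fraction_ext (c := c) (y := - y + y)) => //.
  by apply: fraction_addI => //; rewrite /= /opp_graph opprK.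
by rewrite addNr /= /const_graph mulr0.
Qed.

HB.instance Definition _ := GRing.isZmodule.Build (fraction_ring ore)
  fraction_addA fraction_addC fraction_add0 fraction_addN.

Lemma fraction_mulA : associative fraction_mul.
Proof.
move=> p q s; have [c [y [Cc py]]] := fraction_denom p.
have [d [z [Cd qz]]] := fraction_domain ore y (preP q).
have [e [t [Ce st]]] := fraction_domain ore z (preP s).
have py' : p (e * (d * c)) (e * (d * y)) by do 2!apply: fractionM.
have qz' : q (e * (d * y)) (e * z) by apply: fractionM.
apply: (fraction_ext (c := e * (d * c)) (y := t)).
- by do 2!apply: regularM => //.
- by apply: (fraction_mulI py'); exact: (fraction_mulI qz').
- by apply: fraction_mulI st; exact: (fraction_mulI py').
Qed.

Lemma fraction_mul1 : left_id (fraction_const 1) fraction_mul.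
Proof.
move=> p; have [c [y [Cc py]]] := fraction_denom p.
apply: (fraction_ext (c := c) (y := y)) => //.
by apply: (fraction_mulI (y := c)) => //; rewrite /= /const_graph mulr1.
Qed.

Lemma fraction_1mul : right_id (fraction_const 1) fraction_mul.
Proof.
move=> p; have [c [y [Cc py]]] := fraction_denom p.
apply: (fraction_ext (c := c) (y := y)) => //.
by apply: (fraction_mulI py); rewrite /= /const_graph mulr1.
Qed.

Lemma fraction_mulDl : left_distributive fraction_mul fraction_add.
Proof.
move=> p q s; have [c [y [z [Cc py qz]]]] := fraction_denom2 p q.
have [d [t [Cd st]]] := fraction_domain ore y (preP s).
have [e [u [Ce su]]] := fraction_domain ore (d * z) (preP s).
have py' : p (e * (d * c)) (e * (d * y)) by do 2!apply: fractionM.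
have qz' : q (e * (d * c)) (e * (d * z)) by do 2!apply: fractionM.
have st' : s (e * (d * y)) (e * t) by apply: fractionM.
apply: (fraction_ext (c := e * (d * c)) (y := e * t + u)).
- by do 2!apply: regularM => //.
- apply: (fraction_mulI (fraction_addI py' qz')).
  rewrite -[e * (d * z)]opprK -[u]opprK.
  have [sB sM _ _] := preP s; apply: sB => //.
  by rewrite -mulN1r -(mulN1r u); exact: sM.
- by apply: fraction_addI; [exact: (fraction_mulI py') | exact: (fraction_mulI qz')].
Qed.

Lemma fraction_mulDr : right_distributive fraction_mul fraction_add.
Proof.
move=> p q s; have [c [y [Cc py]]] := fraction_denom p.
have [d [t [Cd qt]]] := fraction_domain ore y (preP q).
have [e [u [Ce su]]] := fraction_domain ore (d * y) (preP s).
have py' : p (e * (d * c)) (e * (d * y)) by do 2!apply: fractionM.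
have qt' : q (e * (d * y)) (e * t) by apply: fractionM.
apply: (fraction_ext (c := e * (d * c)) (y := e * t + u)).
- by do 2!apply: regularM => //.
- by apply: (fraction_mulI py'); exact: fraction_addI.
- by apply: fraction_addI; exact: (fraction_mulI py').
Qed.

Lemma fraction_const_inj : injective fraction_const.
Proof.
move=> r r' e; have := fraction_constI r 1; rewrite e => /=.
by rewrite /const_graph !mul1r.
Qed.

Lemma fraction_one_neq0 : (fraction_const 1 : fraction_ring ore) != fraction_const 0.
Proof. by apply/eqP => /fraction_const_inj/eqP; rewrite oner_eq0. Qed.

HB.instance Definition _ := GRing.Zmodule_isNzRing.Build (fraction_ring ore)
  fraction_mulA fraction_mul1 fraction_1mul fraction_mulDl fraction_mulDr fraction_one_neq0.

End FractionRing.

Section InvertibleElements.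
Variable A : nzRingType.
Implicit Types x y : A.

Definition two_sided_inverse x y : Prop := y * x = 1 /\ x * y = 1.

Definition classical_unit : pred A := [pred x | `[< exists y, two_sided_inverse x y >]].

Definition classical_inv x : A :=
  if pselect (exists y, two_sided_inverse x y) is left h then sval (cid h) else x.

Lemma classical_invP x : classical_unit x -> two_sided_inverse x (classical_inv x).
Proof.
by move=> /asboolP h; rewrite /classical_inv; case: pselect => // h'; case: (cid h').
Qed.

Lemma classical_mulVx : {in classical_unit, left_inverse 1 classical_inv *%R}.
Proof. by move=> x /classical_invP[]. Qed.

Lemma classical_mulxV : {in classical_unit, right_inverse 1 classical_inv *%R}.
Proof. by move=> x /classical_invP[]. Qed.

Lemma classical_unitP x y : y * x = 1 /\ x * y = 1 -> classical_unit x.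
Proof. by move=> h; apply/asboolP; exists y. Qed.

Lemma classical_inv_out : {in [predC classical_unit], classical_inv =1 id}.
Proof.
by move=> x; rewrite inE /= => /asboolP nx; rewrite /classical_inv; case: pselect.
Qed.

End InvertibleElements.

Section Localization.
Variable R : nzRingType.
Local Notation C := (@regular_elements R).
Variable ore : left_ore C.

Local Notation Q := (fraction_ring ore).

HB.instance Definition _ := GRing.NzRing_hasMulInverse.Build (fraction_ring ore)
  (@classical_mulVx Q) (@classical_mulxV Q) (@classical_unitP Q) (@classical_inv_out Q).

Definition fraction_map : R -> Q := @fraction_const R.

Lemma fraction_map_zmod_morphism : zmod_morphism fraction_map.
Proof.
move=> x y; apply: (@fraction_ext _ ore _ _ 1 (x - y)); first exact: regular1.
  by rewrite /= /const_graph mul1r.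
apply: (fraction_addI ore (p := fraction_const x) (q := fraction_opp (@fraction_const R y))).
  by rewrite /= /const_graph mul1r.
by rewrite /= /opp_graph opprK /const_graph mul1r.
Qed.

Lemma fraction_map_monoid_morphism : monoid_morphism fraction_map.
Proof.
split=> // x y; apply: (@fraction_ext _ ore _ _ 1 (x * y)); first exact: regular1.
  by rewrite /= /const_graph mul1r.
apply: (fraction_mulI ore (p := fraction_const x) (q := @fraction_const R y) (y := x)) => //.
by rewrite /= /const_graph mul1r.
Qed.

HB.instance Definition _ := GRing.isZmodMorphism.Build R Q
  fraction_map fraction_map_zmod_morphism.
HB.instance Definition _ := GRing.isMonoidMorphism.Build R Q
  fraction_map fraction_map_monoid_morphism.

Lemma fraction_map_unit c : C c -> fraction_map c \is a GRing.unit.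
Proof.
move=> Cc; apply/unitrP; exists (LeftFraction (inv_graphP Cc)); split.
  apply: (@fraction_ext _ ore _ _ c c) => //.
    apply: (fraction_mulI ore (p := LeftFraction (inv_graphP Cc)) (q := fraction_const c) (y := 1)).
      by rewrite /= /inv_graph mul1r.
    by rewrite /= /const_graph mul1r.
  by rewrite /= /const_graph mulr1.
apply: (@fraction_ext _ ore _ _ 1 1); first exact: regular1.
  apply: (fraction_mulI ore (p := fraction_const c) (q := LeftFraction (inv_graphP Cc)) (y := c)).
    by rewrite /= /const_graph mul1r.
  by rewrite /= /inv_graph mul1r.
by rewrite /= /const_graph mulr1.
Qed.

Lemma fraction_map_localization : is_left_localization C fraction_map.
Proof.
split=> [c|q|r]; first exact: fraction_map_unit.
  have [c [r [Cc qc]]] := fraction_denom q; exists c, r; split=> //.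
  apply: (mulrI (fraction_map_unit Cc)); rewrite mulrA mulrV ?fraction_map_unit // mul1r.
  apply: (@fraction_ext _ ore _ _ 1 r); first exact: regular1.
    apply: (fraction_mulI ore (p := fraction_const c) (q := q) (y := c)) => //.
    by rewrite /= /const_graph mul1r.
  by rewrite /= /const_graph mul1r.
split=> [e|[c Cc cr]]; last by rewrite (regular_mull_eq0 Cc cr) rmorph0.
by exists 1; [exact: regular1 | rewrite (@fraction_const_inj _ _ _ e) mulr0].
Qed.

End Localization.

Lemma left_localization_exists (R : nzRingType) : left_ore (@regular_elements R) ->
  exists (Q : unitRingType) (f : {rmorphism R -> Q}),
    is_left_localization (@regular_elements R) f.
Proof.
by move=> ore; exists (fraction_ring ore), (@fraction_map R ore); exact: fraction_map_localization.
Qed.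

(** * Passage between a ring and its left quotient ring *)
Section Transfer.
Variables (R : nzRingType) (Q : unitRingType) (f : {rmorphism R -> Q}).
Local Notation C := (@regular_elements R).
Hypotheses (ore : left_ore C) (loc : is_left_localization C f).
Implicit Types (I E : set R) (J : set Q).

Lemma localization_unit c : C c -> f c \is a GRing.unit.
Proof. by case: loc => h _ _; exact: h. Qed.

Lemma localization_eq0 r : f r = 0 -> r = 0.
Proof. by case: loc => _ _ h /h[c Cc /(regular_mull_eq0 Cc)]. Qed.

Lemma localization_inj : injective f.
Proof.
move=> x y e; apply/eqP; rewrite -subr_eq0; apply/eqP/localization_eq0.
by rewrite rmorphB e subrr.
Qed.

Lemma localization_denom q : exists c r, C c /\ f c * q = f r.
Proof.
have [_ h _] := loc; have [c [r [Cc ->]]] := h q; exists c, r; split=> //.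
by rewrite mulrA mulrV ?mul1r // localization_unit.
Qed.

Lemma localization_mul_eq0 c q : C c -> f c * q = 0 -> q = 0.
Proof. by move=> Cc e; apply: (mulrI (localization_unit Cc)); rewrite e mulr0. Qed.

Definition contraction J : set R := [set r | J (f r)].

Lemma contraction_ideal J : left_ideal J -> left_ideal (contraction J).
Proof.
move=> hJ; split=> [|x y Jx Jy|a x Jx]; rewrite /contraction /=.
- by rewrite rmorph0; exact: left_ideal0.
- by rewrite rmorphB; exact: left_idealB.
- by rewrite rmorphM; exact: left_idealM.
Qed.

Lemma contraction_essential J : essential J -> essential (contraction J).
Proof.
move=> [hJ essJ]; split; first exact: contraction_ideal.
move=> x x0; have [|q [qx0 Jqx]] := essJ (f x); first by move/localization_eq0.
have [c [r [Cc e]]] := localization_denom q; exists r; split.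
  move=> rx0; apply: qx0; apply: (localization_mul_eq0 Cc).
  by rewrite mulrA e -rmorphM rx0 rmorph0.
by rewrite /contraction /= rmorphM -e -mulrA; exact: left_idealM.
Qed.

Lemma localization_no_proper_essential :
  (forall E, essential E -> exists2 c, E c & C c) -> no_proper_essential Q.
Proof.
move=> hR J essJ; have [c Jc Cc] := hR _ (contraction_essential essJ).
rewrite -(mulVr (localization_unit Cc)); apply: left_idealM => //.
by case: essJ.
Qed.

Lemma localization_no_infinite_direct_sum :
  no_infinite_direct_sum R -> no_infinite_direct_sum Q.
Proof.
move=> nis [A [hA indA]]; apply: nis; exists (fun n => contraction (A n)).
split=> [n|n x Ax hx i].
  have [hAn An0] := hA n; split; first exact: contraction_ideal.
  have [q Aq q0] := left_ideal_neq0 hAn An0 => e.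
  have [c [r [Cc er]]] := localization_denom q.
  apply: q0; apply: (localization_mul_eq0 Cc).
  have : contraction (A n) r by rewrite /contraction /= -er; exact: left_idealM.
  by rewrite e er => ->; rewrite rmorph0.
apply: localization_eq0; apply: (indA n (fun i => f (x i))) => //.
by rewrite -rmorph_sum hx rmorph0.
Qed.

Definition extension I : set Q :=
  [set q | exists c r, [/\ C c, I r & f c * q = f r]].

Lemma extension_ideal I : left_ideal I -> left_ideal (extension I).
Proof.
move=> hI; split.
- by exists 1, 0; rewrite mulr0 rmorph0; split=> //; [exact: regular1 | exact: left_ideal0].
- move=> q q' [c [r [Cc Ir e]]] [c' [r' [Cc' Ir' e']]].
  have [u [v [Cu uv]]] := ore c Cc'.
  exists (u * c), (u * r - v * r'); split; first exact: regularM.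
    by apply: left_idealB => //; exact: left_idealM.
  by rewrite mulrBr {2}uv rmorphB !rmorphM -!mulrA e e'.
- move=> a q [c [r [Cc Ir e]]]; have [d [s [Cd e']]] := localization_denom a.
  have [u [v [Cu uv]]] := ore s Cc.
  exists (u * d), (v * r); split; [exact: regularM | exact: left_idealM |].
  by rewrite mulrA rmorphM -(mulrA (f u)) e' -rmorphM uv !rmorphM -mulrA e.
Qed.

Lemma extensionS I E : I `<=` E -> extension I `<=` extension E.
Proof. by move=> IE q [c [r [Cc Ir e]]]; exists c, r; split=> //; exact: IE. Qed.

Lemma extension_mem I x : I x -> extension I (f x).
Proof. by move=> Ix; exists 1, x; rewrite rmorph1 mul1r; split=> //; exact: regular1. Qed.

Lemma mem_extension I x : extension I (f x) -> exists2 c, C c & I (c * x).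
Proof.
move=> [c [r [Cc Ir e]]]; exists c => //.
by have -> : c * x = r by apply: localization_inj; rewrite rmorphM.
Qed.

(** The extension of an essential [E] is essential, hence contains [1]; clearing
    the denominator of [1] yields a regular element of [E]. *)
Lemma regular_in_essential : no_proper_essential Q ->
  forall E, essential E -> exists2 c, E c & C c.
Proof.
move=> npe E [hE essE]; have [|c Cc Ec] := @mem_extension E 1.
  rewrite rmorph1; apply: npe; split; first exact: extension_ideal.
  move=> q q0; have [c [r [Cc e]]] := localization_denom q.
  have [|s [sr0 Esr]] := essE r.
    by move=> r0; apply: q0; apply: (localization_mul_eq0 Cc); rewrite e r0 rmorph0.
  exists (f s * f c); rewrite -mulrA e -rmorphM.
  by split; [move/localization_eq0 | exact: extension_mem].
by exists c => //; rewrite -[c]mulr1.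
Qed.

(** The extensions of the tails of a direct sum are stationary from some [N]; a
    multiple of an element of [A N] by a regular one then lies in arbitrarily late
    tails, which forces it to vanish. *)
Lemma artinian_no_infinite_direct_sum : left_artinian Q -> no_infinite_direct_sum R.
Proof.
move=> art [A [hA indA]].
have hAl n : left_ideal (A n) by case: (hA n).
have [|n|N hN] := art (fun n => extension (tail_sum A n)).
- by move=> n; apply: extension_ideal; exact: tail_sum_ideal.
- by apply: extensionS; exact: tail_sumS.
have [x Ax x0] := left_ideal_neq0 (hAl N) (hA N).2.
have [m le_Nm hm] := tail_sum_bounded hAl indA (sub_tail_sum hAl Ax).
have [|c Cc Tcx] := @mem_extension (tail_sum A m) x.
  by rewrite hN //; apply: extension_mem; exact: sub_tail_sum.
by apply: x0; apply: (regular_mull_eq0 Cc); exact: hm.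
Qed.

(** A left annihilator is recovered from its extension, because it is stable
    under cancelling a regular left factor. *)
Lemma localization_acc_annihilators : acc (@left_ideal Q) ->
  acc (range (@left_annihilator R)).
Proof.
move=> accQ A hA incA.
have hAl n : left_ideal (A n) by case: (hA n) => X _ <-; exact: left_annihilator_ideal.
have [|n|N hN] := accQ (fun n => extension (A n)).
- by move=> n; exact: extension_ideal.
- exact: extensionS.
exists N => n le_Nn; apply/seteqP; split; last exact: chain_le.
move=> x Ax; have [|c Cc] := @mem_extension (A N) x.
  by rewrite -(hN n) //; exact: extension_mem.
have [X _ <-] := hA N; move=> h y Xy; apply: (regular_mull_eq0 Cc).
by rewrite mulrA; exact: h.
Qed.

End Transfer.

Lemma semisimple_left_quotient_ring_goldie (R : nzRingType) :
  has_semisimple_left_quotient_ring R ->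
  left_goldie R /\ forall E, essential E -> exists2 c, E c & @regular_elements R c.
Proof.
move=> [ore [Q [f [loc [ssQ artQ]]]]].
have npe := semisimple_no_proper_essential ssQ.
have nisR := artinian_no_infinite_direct_sum ore loc artQ.
split; last exact: (regular_in_essential ore loc npe).
split=> //; apply: (localization_acc_annihilators ore loc).
apply: left_ideals_acc => //; exact: (localization_no_infinite_direct_sum loc nisR).
Qed.

Lemma goldie_semisimple_left_quotient_ring (R : nzRingType) :
  semiprime_ring R -> left_goldie R -> has_semisimple_left_quotient_ring R.
Proof.
move=> spR gR; have ore := goldie_ore spR gR.
have [Q [f loc]] := left_localization_exists ore.
split=> //; exists Q, f; split=> //; apply: no_proper_essential_semisimple.
  by apply: (localization_no_proper_essential loc) => E; exact: essential_regular.
by apply: (localization_no_infinite_direct_sum loc); case: gR.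
Qed.

Section SemiprimeFromRegular.
Variable R : nzRingType.

(** Multiply [x] on the left by elements of [N] as long as the result is nonzero:
    the last nonzero product is killed by [N]. *)
Lemma nilpotent_right_annihilator (N : set R) n x : two_sided_ideal N -> x <> 0 ->
  (forall y : 'I_n -> R, (forall i, N (y i)) -> (\prod_(i < n) y i) * x = 0) ->
  exists r, r * x <> 0 /\ right_annihilator N (r * x).
Proof.
move=> hN; elim: n x => [|n IH] x x0 hx.
  by case: x0; rewrite -(hx (fun=> 0)) ?big_ord0 ?mul1r // => -[].
have [h|] := EM (forall y, N y -> y * x = 0); first by exists 1; rewrite mul1r.
move=> /existsNP[y /not_implyP[Ny yx0]].
have [z Nz|r [r0 hr]] := IH (y * x) yx0; last by exists (r * y); rewrite -!mulrA.
pose z' (i : 'I_n.+1) := if unlift ord_max i is Some j then z j else y.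
rewrite mulrA -[RHS](hx z').
  congr (_ * _); rewrite big_ord_recr /=; congr (_ * _); last by rewrite /z' unlift_none.
  apply: eq_bigr => i _; rewrite /z'.
  have -> : widen_ord (leqnSn n) i = lift ord_max i.
    by apply/val_inj; rewrite /= /bump leqNgt ltn_ord.
  by rewrite liftK.
by move=> i; rewrite /z'; case: unliftP.
Qed.

(** The right annihilator of a nilpotent ideal is essential as a left ideal, so
    it contains a regular element; hence the ideal is zero. *)
Lemma regular_in_essential_semiprime :
  (forall E, essential E -> exists2 c, E c & @regular_elements R c) -> semiprime_ring R.
Proof.
move=> hR N [hN [n nilN]]; have [hNl hNr] := hN.
have [|c hc Cc] := hR (right_annihilator N).
  split; last first.
    move=> x x0; apply: (nilpotent_right_annihilator (n := n)) => // y Ny.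
    by rewrite nilN // mul0r.
  split=> [y _|x y hx hy z Nz|a x hx y Ny]; first by rewrite mulr0.
    by rewrite mulrBr hx // hy // subrr.
  by rewrite mulrA; apply: hx; exact: hNr.
apply/seteqP; split=> [x Nx|_ ->] /=; last exact: left_ideal0.
exact: (regular_mulr_eq0 Cc (hc _ Nx)).
Qed.

End SemiprimeFromRegular.

(** * Prime ideals as annihilators in a semiprime Goldie ring *)
Section PrimeIdeals.
Variable R : nzRingType.
Implicit Types (I J K P : set R) (x y r : R).

Lemma two_sided_left_annihilator I : left_ideal I -> two_sided_ideal (left_annihilator I).
Proof.
move=> hI; split; first exact: left_annihilator_ideal.
by move=> x a hx y Iy; rewrite -mulrA; apply: hx; exact: left_idealM.
Qed.

(** The ideals [I] and [J] below contain [x] and [y] and have product in [P]; they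
    replace the ideals generated by [x] and [y], with no sums of products. *)
Lemma prime_ideal_elem P x y : prime_ideal P -> (forall r, P (x * r * y)) -> P x \/ P y.
Proof.
move=> [[[hP Pr] _] primeP] hxy.
pose I : set R := [set z | forall r, P (z * r * y)].
pose J : set R := [set z | forall w, I w -> forall r, P (w * r * z)].
have hI : two_sided_ideal I.
  split; first split.
  - by move=> r; rewrite !mul0r; exact: left_ideal0.
  - by move=> u v Iu Iv r; rewrite !mulrBl; exact: left_idealB.
  - by move=> a u Iu r; rewrite -2!mulrA [u * _]mulrA; exact: left_idealM.
  - by move=> u a Iu r; rewrite -(mulrA u).
have hJ : two_sided_ideal J.
  split; first split.
  - by move=> w _ r; rewrite mulr0; exact: left_ideal0.
  - by move=> u v Ju Jv w Iw r; rewrite mulrBr; apply: left_idealB => //; [exact: Ju | exact: Jv].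
  - by move=> a u Ju w Iw r; rewrite mulrA -(mulrA w); exact: Ju.
  - by move=> u a Ju w Iw r; rewrite mulrA; apply: Pr; exact: Ju.
have [|IP|JP] := primeP _ _ hI hJ.
- by move=> u v Iu Jv; rewrite -[u]mulr1; exact: Jv.
- by left; exact: IP.
- by right; apply: JP => w Iw r; exact: Iw.
Qed.

Lemma elem_prime_ideal P : proper_two_sided_ideal P ->
  (forall x y, (forall r, P (x * r * y)) -> P x \/ P y) -> prime_ideal P.
Proof.
move=> hP primeP; split=> // I J hI hJ IJP.
have [IP|/existsNP[x /not_implyP[Ix Px]]] := EM (I `<=` P); [by left | right].
move=> y Jy; have [r|//|//] := primeP x y; rewrite -mulrA; apply: IJP => //.
by case: hJ => hJ _; exact: left_idealM.
Qed.

Lemma prime_ideal_avoid (s : seq (set R)) P : prime_ideal P ->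
  (forall I, I \in s -> two_sided_ideal I /\ ~ I `<=` P) ->
  exists2 x, (forall I, I \in s -> I x) & ~ P x.
Proof.
move=> primeP; elim: s => [_|I s IH hs].
  by exists 1 => //; case: primeP => -[].
have [|y hy Py] := IH; first by move=> J Js; apply: hs; rewrite inE Js orbT.
have [[hI Ir] /existsNP[x /not_implyP[Ix Px]]] := hs I (mem_head _ _).
have [r Pxry] : exists r, ~ P (x * r * y).
  by apply/existsNP => /(prime_ideal_elem primeP)[].
exists (x * r * y) => // J; rewrite inE => /orP[/eqP->|Js].
  by rewrite -mulrA; exact: Ir.
have [|[hJ _] _] := hs J; first by rewrite inE Js orbT.
by apply: left_idealM => //; exact: hy.
Qed.

Definition annihilator_ideals : set (set R) :=
  [set P | exists I, [/\ two_sided_ideal I, (exists2 x, I x & x <> 0) & P = left_annihilator I]].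

Definition maximal_annihilators : set (set R) :=
  [set P | annihilator_ideals P /\ forall B, annihilator_ideals B -> P `<=` B -> B = P].

Lemma maximal_annihilator_above P : acc (range (@left_annihilator R)) ->
  annihilator_ideals P -> exists2 B, maximal_annihilators B & P `<=` B.
Proof.
move=> accR hP.
have [||B [[hB PB] maxB]] := acc_maximal (G := [set B | annihilator_ideals B /\ P `<=` B]) accR.
- by move=> _ [[I [_ _ ->]] _]; exists I.
- by exists P; split.
by exists B => //; split=> // D hD BD; apply: maxB => //; split=> //; exact: subset_trans BD.
Qed.

Hypothesis spR : semiprime_ring R.

Lemma annihilator_disjoint I x : left_ideal I -> I x -> left_annihilator I x -> x = 0.
Proof.
move=> hI Ix hx; apply: semiprime_elem => // r; rewrite -mulrA; apply: hx.
exact: left_idealM.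
Qed.

(** In a semiprime ring the two annihilators of a two-sided ideal agree. *)
Lemma left_annihilator_sym I x : two_sided_ideal I -> (forall y, I y -> y * x = 0) ->
  left_annihilator I x.
Proof.
move=> [hI Ir] hx y Iy; apply: semiprime_elem => // r.
by rewrite -2!mulrA [y * _]mulrA (mulrA (y * r)) hx ?mul0r ?mulr0 //; exact: Ir.
Qed.

(** Let [P = l(I)] be maximal and [J K] contained in [P], with [K I] nonzero. The
    nonzero ideal [I'] of those elements of [I] that [J] kills contains [K I], and
    [l(I')] contains [P]; so they agree and [J] lies in [P]. Minimality: a prime
    inside [P] contains [P I = 0], hence [P] or [I], and [I] meets [P] in [0]. *)
Lemma maximal_annihilator_minimal_prime P : maximal_annihilators P -> minimal_primes R P.
Proof.
move=> [[I [hI [z Iz z0] ->]] maxP]; have [hIl hIr] := hI.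
split; last first.
  move=> Q primeQ QP; apply/seteqP; split=> //.
  have [[[[hQ _] _]] primeQ'] := (primeQ, primeQ.2).
  have [|//|IQ] := primeQ' _ _ (two_sided_left_annihilator hIl) hI.
    by move=> x y hx /hx ->; exact: left_ideal0.
  by case: z0; apply: (annihilator_disjoint hIl) => //; apply/QP/IQ.
split.
  split; first exact: two_sided_left_annihilator.
  by move=> /(_ z Iz); rewrite mul1r.
move=> J K hJ hK JKP.
have [KP|/existsNP[k /not_implyP[Kk lk]]] := EM (K `<=` left_annihilator I); [by right | left].
have [y /not_implyP[Iy ky0]] : exists y, ~ (I y -> k * y = 0) by exact/existsNP.
have [[hJl hJr] [hKl hKr]] := (hJ, hK).
pose I' := I `&` right_annihilator J.
suff <- : left_annihilator I' = left_annihilator I by move=> x Jx w [_ hw]; exact: hw.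
apply: maxP; last by move=> x hx w [Iw _]; exact: hx.
exists I'; split=> //; last first.
  exists (k * y) => //; split; first exact: left_idealM.
  by move=> j Jj; rewrite mulrA; apply: (JKP j k).
split; first split.
- by split; [exact: left_ideal0 | move=> j _; rewrite mulr0].
- move=> u v [Iu hu] [Iv hv]; split; first exact: left_idealB.
  by move=> j Jj; rewrite mulrBr hu // hv // subrr.
- move=> a u [Iu hu]; split; first exact: left_idealM.
  by move=> j Jj; rewrite mulrA hu //; exact: hJr.
- move=> u a [Iu hu]; split; first exact: hIr.
  by move=> j Jj; rewrite mulrA hu // mul0r.
Qed.

Lemma prime_ideal_two_sided P : prime_ideal P -> two_sided_ideal P.
Proof. by move=> [[]]. Qed.

(** If [l(I)] and [l(I')] are distinct maximal annihilators, then [I I' = 0], as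
    [l(I')] is a prime containing [l(I) I = 0] and distinct minimal primes are
    incomparable. So ideals [I] chosen one for each maximal annihilator form a
    direct sum. *)
Lemma maximal_annihilators_finite : no_infinite_direct_sum R ->
  finite_set maximal_annihilators.
Proof.
move=> nis; apply: contrapT => /infiniteP/ppcard_leP[g].
have gM n : maximal_annihilators (g n) by exact: funS.
have ginj n m : g n = g m -> n = m by apply: (inj (f := g)); rewrite inE.
have /choice[I hI] n : exists I, [/\ two_sided_ideal I, (exists2 x, I x & x <> 0) &
    g n = left_annihilator I].
  by case: (gM n).
have prod0 i j x y : i <> j -> I i x -> I j y -> x * y = 0.
  move=> neq_ij Ix; have [hIi _ gi] := hI i; have [hIj _ gj] := hI j.
  have [primei mini] := maximal_annihilator_minimal_prime (gM i).
  have [primej minj] := maximal_annihilator_minimal_prime (gM j).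
  have [|ij|IP] := primej.2 _ _ (prime_ideal_two_sided primei) hIi.
  - move=> u v; rewrite gi => hu /hu ->; apply: left_ideal0.
    by case: (prime_ideal_two_sided primej).
  - by case: neq_ij; apply: ginj; apply: minj.
  - by move: (IP x Ix); rewrite gj; exact.
apply: nis; exists I; split=> [n|n x Ix x0 j].
  have [[hIn _] [x Ix x0] _] := hI n; split=> // e; apply: x0.
  by move: Ix; rewrite e.
have [[hIj _] _ _] := hI j; apply: (annihilator_disjoint hIj) => // y Iy.
have := congr1 ( *%R^~ y) x0; rewrite /= mul0r mulr_suml (bigD1 j) //= big1 ?addr0 //.
move=> i /eqP neq_ij; apply: (prod0 i j) => // e; apply: neq_ij; exact: val_inj.
Qed.

(** The intersection [N], if nonzero, has its annihilator inside some maximal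
    [P = l(I)]. As [N] lies in [P] too, [N I = 0], so [I N = 0] by symmetry of
    annihilators; thus [I] lies in [l(N)], hence in [P], which [I] meets in [0]. *)
Lemma bigcap_maximal_annihilators x : acc (range (@left_annihilator R)) ->
  (forall P, maximal_annihilators P -> P x) -> x = 0.
Proof.
move=> accR hx; pose N : set R := [set y | forall P, maximal_annihilators P -> P y].
have two_sided P : maximal_annihilators P -> two_sided_ideal P.
  by move=> /maximal_annihilator_minimal_prime[/prime_ideal_two_sided].
have hN : two_sided_ideal N.
  split; first split.
  - by move=> P /two_sided[hP _]; exact: left_ideal0.
  - move=> u v Nu Nv P mP; have [hP _] := two_sided _ mP.
    by apply: left_idealB => //; [exact: Nu | exact: Nv].
  - by move=> a u Nu P mP; have [hP _] := two_sided _ mP; apply: left_idealM => //; exact: Nu.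
  - by move=> u a Nu P mP; have [_ hP] := two_sided _ mP; apply: hP; exact: Nu.
apply: contrapT => x0.
have [|P mP lNP] := @maximal_annihilator_above (left_annihilator N) accR.
  by exists N; split=> //; exists x.
have [[I [[hI hIr] [z Iz z0] eP]] _] := mP.
apply: z0; apply: (annihilator_disjoint hI) => //; rewrite -eP; apply: lNP.
apply: left_annihilator_sym => // y /(_ P mP); rewrite eP; exact.
Qed.

(** A prime contains the finite intersection of all maximal annihilators, which is
    zero, hence contains one of them. *)
Lemma minimal_primesE : left_goldie R -> minimal_primes R = maximal_annihilators.
Proof.
move=> [accR nis]; apply/seteqP; split; last exact: maximal_annihilator_minimal_prime.
move=> p [primep minp].
have [s hs] : exists s : seq (set R), maximal_annihilators = [set` s].
  by apply/finite_seqP; exact: maximal_annihilators_finite.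
suff [P mP Pp] : exists2 P, maximal_annihilators P & P `<=` p.
  by rewrite -(minp P) //; case: (maximal_annihilator_minimal_prime mP).
apply: contrapT => h.
have [P Ps|x hx px] := prime_ideal_avoid (s := s) primep.
  have mP : maximal_annihilators P by rewrite hs.
  split; last by move=> Pp; apply: h; exists P.
  by case: (maximal_annihilator_minimal_prime mP) => /prime_ideal_two_sided.
apply: px; rewrite (bigcap_maximal_annihilators (x := x) accR).
  by apply: left_ideal0; case: (prime_ideal_two_sided primep).
by move=> P; rewrite hs; exact: hx.
Qed.

Lemma quotient_proj_eq0 I (hI : proper_two_sided_ideal I) x :
  quotient_proj hI x = 0 <-> I x.
Proof. by rewrite -(rmorph0 (quotient_proj hI)) quotient_projE subr0. Qed.

(** Modulo [p = l(I)], killing [X] amounts to killing [X I] in [R], so left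
    annihilators of the quotient pull back to left annihilators of [R]; and as
    [I] meets [p] trivially, a direct sum of nonzero left ideals of the quotient is
    cut down to one inside [I]. *)
Lemma quotient_annihilator_goldie I (hp : proper_two_sided_ideal (left_annihilator I)) :
  two_sided_ideal I -> left_goldie R -> left_goldie (quotient_ring hp).
Proof.
move=> hI [accR nis]; have [hIl hIr] := hI; pose pi := quotient_proj hp.
have pi_surj q : exists x, q = pi x by exists (repr q); rewrite /pi quotient_projK.
have pi0 x : pi x = 0 <-> left_annihilator I x by exact: quotient_proj_eq0.
split.
  move=> A hA incA.
  have [n|n x|N hN] := accR (fun n => [set r | A n (pi r)]).
  - have [X _ <-] := hA n.
    exists [set t | exists x y, [/\ X (pi x), I y & t = x * y]] => //.
    apply/seteqP; split=> [r hr q Xq|r hr _ [x [y [Xx Iy ->]]]].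
      have [x eq] := pi_surj q; subst q; rewrite -rmorphM; apply/pi0 => y Iy.
      by rewrite -mulrA; apply: hr; exists x, y.
    rewrite mulrA; have /pi0 : pi (r * x) = 0 by rewrite /pi rmorphM; exact: hr.
    exact.
  - exact: incA.
  exists N => n le_Nn; apply/seteqP; split=> q; have [x ->] := pi_surj q => Aq.
    by have : [set r | A n (pi r)] x by []; rewrite hN.
  by have : [set r | A N (pi r)] x by []; rewrite -(hN n).
move=> [A [hA indA]]; apply: nis.
exists (fun n => I `&` [set r | A n (pi r)]); split=> [n|n x Bx x0 i].
  have [hAn An0] := hA n.
  have hB : left_ideal [set r | A n (pi r)].
    split=> [|x y Ax Ay|a x Ax] /=; rewrite /pi.
    - by rewrite rmorph0; exact: left_ideal0.
    - by rewrite rmorphB; exact: left_idealB.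
    - by rewrite rmorphM; exact: left_idealM.
  split; first exact: left_idealI.
  move=> B0; have [q Aq q0] := left_ideal_neq0 hAn An0.
  have [x eq] := pi_surj q; subst q; apply: q0; apply/pi0.
  apply: left_annihilator_sym => // y Iy.
  have : (I `&` [set r | A n (pi r)]) (y * x).
    by split; [exact: hIr | exact: left_idealM].
  by rewrite B0.
have [Ixi Axi] := Bx i; apply: (annihilator_disjoint hIl) => //.
apply/pi0; apply: (indA n (fun i => pi (x i))) => [j|].
  by have [] := Bx j.
by rewrite /pi -rmorph_sum x0 rmorph0.
Qed.

End PrimeIdeals.

(** * Minimal primes of a semiprime ring *)
Section MinimalPrimes.
Variable R : nzRingType.
Implicit Types (I J K P Q : set R) (a x y r : R).

Lemma left_sum_two_sided I J : two_sided_ideal I -> two_sided_ideal J ->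
  two_sided_ideal (left_sum I J).
Proof.
move=> [hI Ir] [hJ Jr]; split; first exact: left_sum_ideal.
move=> _ a [y [z [Iy Jz ->]]]; exists (y * a), (z * a); rewrite mulrDl.
by split=> //; [exact: Ir | exact: Jr].
Qed.

(** As [b R b] is nonzero for each nonzero [b], there is a sequence of nonzero
    elements starting at [a] in which [u n.+1] lies in [u n R u n]. An ideal
    maximal among those that miss the whole sequence is prime. *)
Lemma semiprime_prime_avoiding a : semiprime_ring R -> a <> 0 ->
  exists2 P, prime_ideal P & ~ P a.
Proof.
move=> spR a0.
have step (b : {b : R | b <> 0}) : exists r, sval b * r * sval b <> 0.
  by case: b => b b0 /=; apply/existsNP => h; apply: b0; exact: semiprime_elem.
have [g hg] := choice step.
pose next (b : {b : R | b <> 0}) : {b : R | b <> 0} := 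
  exist (fun b => b <> 0) (sval b * g b * sval b) (hg b).
pose u n := sval (iter n next (exist (fun b => b <> 0) a a0)).
have uS n : exists r, u n.+1 = u n * r * u n.
  by exists (g (iter n next (exist (fun b => b <> 0) a a0))).
pose U : set (R -> R) := [set f | exists b c, forall x, f x = b * x * c].
have stableP K : stable_subgroup U K <-> two_sided_ideal K.
  split=> [[K0 KB KM]|[[K0 KB KM] Kr]].
    split=> [|x b Kx]; first split=> // b x Kx.
      by apply: (KM (fun x => b * x)) => //; exists b, 1 => y; rewrite mulr1.
    by apply: (KM (fun x => x * b)) => //; exists 1, b => y; rewrite mul1r.
  by split=> // f x [b [c ->]] Kx; apply: Kr; exact: KM.
have [||K [/stableP hK disj maxK]] := @maximal_stable_subgroup _ U (range u).
- by move=> f [b [c ->]]; rewrite mulr0 mul0r.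
- by move=> [n _]; rewrite /u; case: (iter n next _).
have [hKl hKr] := hK.
exists K; last by move=> Ka; apply: (disj a) => //; exists 0%N.
have meets I : two_sided_ideal I -> ~ I `<=` K -> exists n, left_sum K I (u n).
  move=> hI IK; apply: contrapT => h; apply: IK.
  suff <- : left_sum K I = K by apply: left_sum_subr; exact: hKl.
  apply: maxK; first by apply/stableP; exact: left_sum_two_sided.
    by apply: left_sum_subl; case: hI.
  by move=> x Lx [n _ e]; apply: h; exists n; rewrite e.
have later I n m : two_sided_ideal I -> (n <= m)%N -> I (u n) -> I (u m).
  move=> [hI _] /subnK <-; elim: (m - n)%N => // k IH /IH Iu.
  by rewrite addSn; have [r ->] := uS (k + n)%N; exact: left_idealM.
split=> [|I J hI hJ IJK].
  split=> // K1; apply: (disj a); last by exists 0%N.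
  by rewrite -[a]mulr1; exact: left_idealM.
have [|IK] := EM (I `<=` K); [by left | right].
apply: contrapT => JK.
have [i ui] := meets I hI IK; have [j uj] := meets J hJ JK.
pose m := maxn i j.
have := later _ _ m (left_sum_two_sided hK hI) (leq_maxl _ _) ui.
have := later _ _ m (left_sum_two_sided hK hJ) (leq_maxr _ _) uj.
move=> [k' [y [Kk' Jy e']]] [k [x [Kk Ix e]]].
have [r er] := uS m.
apply: (disj (u m.+1)); last by exists m.+1.
rewrite er {1}e mulrDl mulrDl; apply: left_idealD => //; first exact/hKr/hKr.
rewrite e' mulrDr; apply: left_idealD => //; first exact: left_idealM.
by apply: IJK => //; case: hI => _; exact.
Qed.

Lemma prime_ideal_chain (G : set (set R)) : (exists P, G P) ->
  (forall P, G P -> prime_ideal P) -> total_on G subset ->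
  prime_ideal [set x | forall P, G P -> P x].
Proof.
move=> [P0 GP0] primeG totG; apply: elem_prime_ideal.
  split; last by move=> /(_ P0 GP0); case: (primeG _ GP0) => -[].
  split; first split.
  - by move=> P /primeG/prime_ideal_two_sided[hP _]; exact: left_ideal0.
  - move=> x y hx hy P GP; have [hP _] := prime_ideal_two_sided (primeG _ GP).
    by apply: left_idealB => //; [exact: hx | exact: hy].
  - move=> a x hx P GP; have [hP _] := prime_ideal_two_sided (primeG _ GP).
    by apply: left_idealM => //; exact: hx.
  - move=> x a hx P GP; have [_ hP] := prime_ideal_two_sided (primeG _ GP).
    by apply: hP; exact: hx.
move=> x y hxy; apply: contrapT => /not_orP[].
move=> /existsNP[P /not_implyP[GP Px]] /existsNP[Q /not_implyP[GQ Qy]].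
have [PQ|QP] := totG _ _ GP GQ.
  have [r|//|/PQ//] := @prime_ideal_elem _ P x y (primeG _ GP).
  exact: hxy.
have [r|/QP//|//] := @prime_ideal_elem _ Q x y (primeG _ GQ).
exact: hxy.
Qed.

(** Zorn's lemma downwards, chains of primes having prime intersections. *)
Lemma minimal_prime_below P : prime_ideal P -> exists2 p, minimal_primes R p & p `<=` P.
Proof.
move=> primeP.
pose T := {Q : set R | prime_ideal Q /\ Q `<=` P}.
pose sub Q (primeQ : prime_ideal Q) (QP : Q `<=` P) : T :=
  exist (fun Q => prime_ideal Q /\ Q `<=` P) Q (conj primeQ QP).
pose t0 : T := sub P primeP (@subset_refl _ P).
pose r (A B : T) := `[< sval B `<=` sval A >].
have [A|B A C|A totA|[p [primep pP]] minp] := @ZL_preorder T t0 r.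
- exact/asboolP.
- by move=> /asboolP AB /asboolP BC; apply/asboolP; exact: subset_trans AB.
- have [[B AB]|nA] := EM (exists B, A B); last first.
    by exists t0 => B AB; case: nA; exists B.
  pose G : set (set R) := [set Q | exists2 B : T, A B & Q = sval B].
  have primeG : prime_ideal [set x | forall Q, G Q -> Q x].
    apply: prime_ideal_chain; first by exists (sval B), B.
      by move=> _ [D _ ->]; case: (svalP D).
    move=> _ _ [D AD ->] [D' AD' ->].
    by have [/asboolP|/asboolP] := totA _ _ AD AD'; [right | left].
  have subG : [set x | forall Q, G Q -> Q x] `<=` P.
    by move=> x hx; apply: (svalP B).2; apply: hx; exists B.
  exists (sub _ primeG subG) => D AD; apply/asboolP => x /= hx.
  by apply: hx; exists D.
exists p => //; split=> // Q primeQ Qp.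
have QP : Q `<=` P := subset_trans Qp pP.
have /asboolP/= pQ := minp (sub Q primeQ QP) (asboolT Qp).
by apply/seteqP.
Qed.

Lemma bigcap_minimal_primes x : semiprime_ring R ->
  (forall p, minimal_primes R p -> p x) -> x = 0.
Proof.
move=> spR hx; apply: contrapT => /(semiprime_prime_avoiding spR)[P primeP]; apply.
by have [p minp pP] := minimal_prime_below primeP; apply: pP; exact: hx.
Qed.

End MinimalPrimes.

(** * The Goldie conditions from finitely many factor rings *)
Section GoldieFromFactors.
Variable R : nzRingType.
Implicit Types (I L p : set R).

(** Left annihilators modulo [p], written with subsets of [R] rather than of the
    quotient, since the same [X] has to serve for all [p] at once. *)
Lemma chain_annihilator_mod p (hp : proper_two_sided_ideal p) (X : nat -> set R) :
  acc (range (@left_annihilator (quotient_ring hp))) ->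
  (forall n, X n.+1 `<=` X n) ->
  exists N, forall n, (N <= n)%N -> forall r,
    (forall x, X n x -> p (r * x)) -> forall x, X N x -> p (r * x).
Proof.
move=> accp decX.
have [n|n q hq _ [x Xx <-]|N hN] :=
  accp (fun n => left_annihilator [set quotient_proj hp x | x in X n]).
- by exists [set quotient_proj hp x | x in X n].
- by apply: hq; exists x => //; exact: decX.
exists N => n le_Nn r hr x Xx; apply/(quotient_proj_eq0 hp); rewrite rmorphM.
suff : left_annihilator [set quotient_proj hp x | x in X N] (quotient_proj hp r).
  by apply; exists x.
rewrite -(hN n) // => _ [y Xy <-]; rewrite -rmorphM.
by apply/quotient_proj_eq0; exact: hr.
Qed.

(** Replace each annihilator [A n] by [l(X n)] with [X n] its right annihilator, a
    descending chain. Modulo each of the finitely many [p] the annihilators of the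
    [X n] become stationary, and an element annihilates [X n] when it does so
    modulo every [p]. *)
Lemma acc_annihilators_of_factors (s : seq (set R)) :
  (forall x, (forall p, p \in s -> p x) -> x = 0) ->
  (forall p, p \in s -> exists hp : proper_two_sided_ideal p,
     acc (range (@left_annihilator (quotient_ring hp)))) ->
  acc (range (@left_annihilator R)).
Proof.
move=> cap0 accs A hA incA; pose X n := right_annihilator (A n).
have AX n : left_annihilator (X n) = A n.
  by rewrite /X; have [Y _ <-] := hA n; exact: left_right_left_annihilator.
have decX n : X n.+1 `<=` X n by move=> x hx y Ay; apply: hx; exact: incA.
have [N hN] : exists N, forall p, p \in s -> forall n, (N <= n)%N -> forall r,
    (forall x, X n x -> p (r * x)) -> forall x, X N x -> p (r * x).
  elim: s accs {cap0} => [|p s IH] accs; first by exists 0%N.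
  have [|N hN] := IH; first by move=> q qs; apply: accs; rewrite inE qs orbT.
  have [hp accp] := accs p (mem_head _ _).
  have [M hM] := chain_annihilator_mod accp decX.
  exists (maxn N M) => q; rewrite inE => /orP[/eqP->|qs] n;
    rewrite geq_max => /andP[leN leM] r hr x Xx.
    apply: (hM n leM r hr); exact: (chain_ge decX (leq_maxr N M)).
  apply: (hN q qs n leN r hr); exact: (chain_ge decX (leq_maxl N M)).
exists N => n le_Nn; apply/seteqP; split; last exact: chain_le.
move=> r Ar; rewrite -AX => x Xx; apply: cap0 => p ps.
apply: (hN p ps n) => // y Xy; rewrite Xy //.
have [hp _] := accs p ps; case: hp => -[hp _] _; exact: left_ideal0.
Qed.

(** Relative form, to allow an induction on the number of primes. *)
Definition no_infinite_direct_sum_in L : Prop :=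
  ~ exists A : nat -> set R,
      (forall n, [/\ left_ideal (A n), A n <> [set 0] & A n `<=` L]) /\ independent A.

(** Given an infinite direct sum in [L], either some tail meets [p] trivially, and
    then embeds into the quotient ring; or each tail contains a nonzero element of
    [p], and elements taken from sufficiently distant tails generate independent
    left ideals inside [p]. This replaces the additivity of uniform dimension. *)
Lemma no_infinite_direct_sum_extension p (hp : proper_two_sided_ideal p) L :
  left_ideal L -> no_infinite_direct_sum (quotient_ring hp) ->
  no_infinite_direct_sum_in (L `&` p) -> no_infinite_direct_sum_in L.
Proof.
move=> hL nisq nisp [A [hA indA]].
have hAl n : left_ideal (A n) by case: (hA n).
have hT n := tail_sum_ideal hAl n.
have [[n hn]|h] := EM (exists n, forall x, tail_sum A n x -> p x -> x = 0).
  apply: nisq; exists (fun k => [set quotient_proj hp x | x in A (n + k)%N]).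
  have subT k x : A (n + k)%N x -> tail_sum A n x.
    move=> Ax; apply: (@chain_ge _ (tail_sum A) _ n (n + k)) (leq_addr _ _) _ _.
      by move=> m; exact: tail_sumS.
    exact: sub_tail_sum.
  split=> [k|k q Aq sumq i].
    split.
      split=> [|_ _ [x Ax <-] [y Ay <-]|b _ [x Ax <-]].
      - by exists 0; [exact: left_ideal0 | rewrite rmorph0].
      - by exists (x - y); [exact: left_idealB | rewrite rmorphB].
      - exists (repr b * x); first exact: left_idealM.
        by rewrite -[b in RHS]quotient_projK -rmorphM.
    have [_ An0 _] := hA (n + k)%N; move=> e.
    have [x Ax x0] := left_ideal_neq0 (hAl _) An0.
    apply: x0; apply: hn; first exact: (subT k).
    apply/(quotient_proj_eq0 hp).
    have : [set quotient_proj hp x | x in A (n + k)%N] (quotient_proj hp x) by exists x.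
    by rewrite e.
  have /choice[x hx] (j : 'I_k) : exists x, A (n + j)%N x /\ quotient_proj hp x = q j.
    by have [x Ax e] := Aq j; exists x.
  have Ax (j : 'I_k) : A (n + j)%N (x j) by case: (hx j).
  have sumx : \sum_(i < k) x i = 0.
    apply: hn; first by apply: left_ideal_sum => // j; exact: (subT j).
    apply/(quotient_proj_eq0 hp); rewrite rmorph_sum -[RHS]sumq.
    by apply: eq_bigr => j _; case: (hx j).
  have := independent_shift hAl indA Ax sumx i; have [_ <-] := hx i => ->.
  by rewrite rmorph0.
have /choice[g hg] n : exists xm : R * nat, [/\ tail_sum A n xm.1, p xm.1, xm.1 <> 0,
    (n <= xm.2)%N & forall r, tail_sum A xm.2 (r * xm.1) -> r * xm.1 = 0].
  have [x [Tx px x0]] : exists x, [/\ tail_sum A n x, p x & x <> 0].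
    apply: contrapT => hn; apply: h; exists n => x Tx px.
    by apply: contrapT => x0; apply: hn; exists x.
  by have [m le_nm hm] := tail_sum_bounded hAl indA Tx; exists (x, m).
pose u k := iter k (fun n => (g n).2) 0%N.
apply: nisp; exists (fun k => principal_left (g (u k)).1); split=> [k|].
  have [Tx px x0 _ _] := hg (u k); split; first exact: principal_left_ideal.
    move=> e; apply: x0; have := principal_left_gen (g (u k)).1.
    by rewrite e.
  apply: principal_left_sub.
    by apply: left_idealI => //; have [[]] := hp.
  split=> //; apply: tail_sum_sub Tx => // i; by case: (hA i).
apply: (@independent_descending _ (fun k => tail_sum A (u k))) => [k|k|k|k _ [r ->]].
- exact: hT.
- apply: chain_ge; first by move=> m; exact: tail_sumS.
  by case: (hg (u k)).
- by apply: principal_left_sub => //; case: (hg (u k)).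
- by have [_ _ _ _] := hg (u k); exact.
Qed.

Lemma no_infinite_direct_sum_of_factors (s : seq (set R)) :
  (forall x, (forall p, p \in s -> p x) -> x = 0) ->
  (forall p, p \in s -> exists hp : proper_two_sided_ideal p,
     no_infinite_direct_sum (quotient_ring hp)) ->
  no_infinite_direct_sum R.
Proof.
move=> cap0 niss.
suff main L : left_ideal L ->
    no_infinite_direct_sum_in (L `&` [set x | forall p, p \in s -> p x]) ->
    no_infinite_direct_sum_in L.
  move=> [A [hA indA]]; apply: (main setT) => //.
    move=> [B [hB _]]; have [hB0 Bn0 Bs] := hB 0%N; apply: Bn0; apply/seteqP.
    by split=> [x /Bs[_ /cap0]|_ ->] //; exact: left_ideal0.
  by exists A; split=> // n; have [] := hA n.
elim: s niss L {cap0} => [|p s IH] niss L hL hs.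
  suff e : L `&` [set x | forall p, p \in [::] -> p x] = L by rewrite e in hs.
  by apply/seteqP; split=> x; [case | ].
have [hp nisp] := niss p (mem_head _ _).
apply: (no_infinite_direct_sum_extension hL nisp); apply: IH.
- by move=> q qs; apply: niss; rewrite inE qs orbT.
- by apply: left_idealI => //; have [[]] := hp.
- move=> [A [hA indA]]; apply: hs; exists A; split=> // n.
  have [hAn An0 AL] := hA n; split=> // x /AL[[Lx px] hx]; split=> // q.
  by rewrite inE => /orP[/eqP->//|]; exact: hx.
Qed.

End GoldieFromFactors.

(** * Semisimple left quotient rings and minimal primes *)
Theorem theorem5p1 (R : nzRingType) :
  has_semisimple_left_quotient_ring R <->
  [/\ semiprime_ring R,
      finite_set (minimal_primes R)
    & forall (p : set R) (p_min : minimal_primes R p),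
        left_goldie (quotient_ring (minimal_prime_proper p_min))].
Proof.
split=> [/semisimple_left_quotient_ring_goldie[gR regR]|[spR]].
  have spR := regular_in_essential_semiprime regR; split=> //.
    rewrite minimal_primesE //; apply: maximal_annihilators_finite => //.
    by case: gR.
  move=> p p_min; have := p_min; rewrite minimal_primesE // => -[[I [hI _ eq]] _].
  by move: (minimal_prime_proper p_min); rewrite eq => hp; exact: quotient_annihilator_goldie.
move=> /finite_seqP[s hs] gmin.
have mins p : p \in s -> minimal_primes R p by rewrite hs.
have cap0 x : (forall p, p \in s -> p x) -> x = 0.
  by move=> hx; apply: bigcap_minimal_primes => // p; rewrite hs; exact: hx.
apply: goldie_semisimple_left_quotient_ring => //; split.
  apply: (acc_annihilators_of_factors cap0) => p /mins p_min.
  by exists (minimal_prime_proper p_min); case: (gmin p p_min).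
apply: (no_infinite_direct_sum_of_factors cap0) => p /mins p_min.
by exists (minimal_prime_proper p_min); case: (gmin p p_min).
Qed.
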